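(* Let $\beta=(\beta_n)_{n\ge0}$ be an essentially decreasing sequence of positive numbers with $\liminf_n\beta_n^{1/n}\ge1$, satisfying the $\Delta_2$-condition. Then for every symbol $\phi$, the composition operator $C_\phi$ is bounded on $H^2(\beta)$.
   Context: $H^2(\beta)$ is the Hilbert space of analytic functions $f(z)=\sum_{n\ge0}a_nz^n$ on the unit disk $\mathbb D$ with $\|f\|^2=\sum_{n\ge0}|a_n|^2\beta_n<\infty$. A symbol is a non-constant analytic map $\phi:\mathbb D\to\mathbb D$ and $C_\phi f=f\circ\phi$. $\beta$ is essentially decreasing if there is $C\ge1$ with $\beta_m\le C\beta_n$ for all $m\ge n\ge0$. $\beta$ satisfies the $\Delta_2$-condition if there is $\delta\in(0,1)$ with $\beta_{2n}\ge\delta\beta_n$ for all $n\ge0$. *)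

(* Defs.v *)
From Stdlib Require Import Reals.
From Coquelicot Require Export Coquelicot.
Open Scope R_scope.

Definition in_disk (z : C) : Prop := Cmod z < 1.

Definition ess_decreasing (beta : nat -> R) : Prop :=
  exists K : R, 1 <= K /\ forall m n : nat, (n <= m)%nat -> beta m <= K * beta n.

Definition Delta2 (beta : nat -> R) : Prop :=
  exists delta : R, 0 < delta < 1 /\ forall n : nat, beta (2 * n)%nat >= delta * beta n.

(* f = sum a_n z^n belongs to H^2(beta): sum |a_n|^2 beta_n < oo *)
Definition in_H2 (beta : nat -> R) (a : nat -> C) : Prop :=
  ex_series (fun n => (Cmod (a n)) ^ 2 * beta n).

Definition H2_norm2 (beta : nat -> R) (a : nat -> C) : R :=
  Series (fun n => (Cmod (a n)) ^ 2 * beta n).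

Definition symbol (phi : C -> C) : Prop :=
  (exists b : nat -> C, forall z, in_disk z -> is_pseries b z (phi z)) /\
  (forall z, in_disk z -> in_disk (phi z)) /\
  (exists z1 z2, in_disk z1 /\ in_disk z2 /\ phi z1 <> phi z2).

(* C_phi is a bounded operator on H^2(beta): for every f = sum a_n z^n in
   H^2(beta), f o phi is (on D) an element sum c_n z^n of H^2(beta), and
   ||f o phi|| <= M ||f|| (stated with squared norms). *)
Definition comp_bounded (beta : nat -> R) (phi : C -> C) : Prop :=
  exists M : R, 0 <= M /\
    forall a : nat -> C, in_H2 beta a ->
      exists c : nat -> C,
        in_H2 beta c /\
        (forall z, in_disk z -> exists w : C, is_pseries a (phi z) w /\ is_pseries c z w) /\
        H2_norm2 beta c <= M * H2_norm2 beta a.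

(* Main.v *)
Require Import Defs.
From Stdlib Require Import Reals Lra Lia.
From Coquelicot Require Import Coquelicot.
Open Scope R_scope.

(* Let c(n,m) be the m-th Taylor coefficient of phi^n, so that f o phi has coefficients
   c_m = sum_n a_n c(n,m).

   On the unweighted space, composition is bounded by subordination: for a polynomial p, |p|^2 is at
   most the harmonic extension Re h of its boundary values, so the square mean of p o phi is at most
   Re h(phi(0)), which is at most a constant times the square norm of p.

   For a weight one may assume beta decreasing (replace it by its running minimum). Near 0 we have
   |phi| <= rho < 1 on some disk |z| <= r, whence |c(n,m)| <= rho^n r^(-m): the first k coefficients
   of f o phi depend, up to an error controlled by sum |a_n| rho^(n/2), only on the first A k
   coefficients of f, for a fixed A. Comparing partial sums of squares for every k and summing by
   parts against the decreasing weight gives the weighted estimate, the Delta_2 condition comparing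
   beta_k with beta_n for n < A (k + 1). The estimate is uniform over polynomials f, and passes to
   the limit since point evaluations are continuous. *)

(** * Finite sums *)

Fixpoint rsum (u : nat -> R) (n : nat) : R :=
  match n with O => 0 | S n => rsum u n + u n end.

Fixpoint csum (u : nat -> C) (n : nat) : C :=
  match n with O => 0 | S n => csum u n + u n end%C.

Lemma rsum_ext u v n : (forall k, (k < n)%nat -> u k = v k) -> rsum u n = rsum v n.
Proof.
  induction n as [|n IH]; intros H; simpl; auto.
  rewrite IH, H; auto.
Qed.

Lemma rsum_le u v n : (forall k, (k < n)%nat -> u k <= v k) -> rsum u n <= rsum v n.
Proof.
  induction n as [|n IH]; intros H; simpl; [lra|].
  apply Rplus_le_compat; auto.
Qed.

Lemma rsum_plus u v n : rsum (fun k => u k + v k) n = rsum u n + rsum v n.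
Proof. induction n as [|n IH]; simpl; [|rewrite IH]; ring. Qed.

Lemma rsum_scal c u n : rsum (fun k => c * u k) n = c * rsum u n.
Proof. induction n as [|n IH]; simpl; [|rewrite IH]; ring. Qed.

Lemma rsum_nonneg u n : (forall k, 0 <= u k) -> 0 <= rsum u n.
Proof. intros H; induction n as [|n IH]; simpl; [lra|]. specialize (H n); lra. Qed.

Lemma rsum_mono u n m : (forall k, 0 <= u k) -> (n <= m)%nat -> rsum u n <= rsum u m.
Proof.
  intros H; induction 1 as [|m _ IH]; simpl; [lra|]. specialize (H m); lra.
Qed.

Lemma rsum_term_le u n k : (forall k, 0 <= u k) -> (k < n)%nat -> u k <= rsum u n.
Proof.
  intros H Hk. apply Rle_trans with (rsum u (S k)).
  - simpl. generalize (rsum_nonneg u k H); lra.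
  - apply rsum_mono; auto.
Qed.

Lemma rsum_first u n : rsum u (S n) = u O + rsum (fun k => u (S k)) n.
Proof.
  induction n as [|n IH]; [simpl; ring|].
  change (rsum u (S n) + u (S n) = u O + (rsum (fun k => u (S k)) n + u (S n))).
  rewrite IH; ring.
Qed.

Lemma rsum_geom q n : q <> 1 -> rsum (fun k => q ^ k) n = (1 - q ^ n) / (1 - q).
Proof.
  intros Hq; induction n as [|n IH]; simpl; [|rewrite IH]; field; lra.
Qed.

Lemma rsum_geom_le q n : 0 <= q < 1 -> rsum (fun k => q ^ k) n <= / (1 - q).
Proof.
  intros Hq. rewrite rsum_geom by lra. unfold Rdiv.
  rewrite <- (Rmult_1_l (/ (1 - q))) at 2.
  apply Rmult_le_compat_r.
  - left; apply Rinv_0_lt_compat; lra.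
  - generalize (pow_le q n); lra.
Qed.

Lemma rsum_cauchy_schwarz x y n :
  rsum (fun k => x k * y k) n ^ 2 <= rsum (fun k => x k ^ 2) n * rsum (fun k => y k ^ 2) n.
Proof.
  induction n as [|n IH]; [simpl; lra|].
  cbn [rsum].
  set (s := rsum (fun k => x k * y k) n) in *.
  set (X := rsum (fun k => x k ^ 2) n) in *.
  set (Y := rsum (fun k => y k ^ 2) n) in *.
  assert (HX : 0 <= X) by (apply rsum_nonneg; intros; apply pow2_ge_0).
  assert (HY : 0 <= Y) by (apply rsum_nonneg; intros; apply pow2_ge_0).
  set (a := x n); set (b := y n). clearbody s X Y a b.
  (* AM-GM: [2 s a b <= X b^2 + Y a^2], since [s^2 <= X Y] *)
  assert (H : 2 * (s * (a * b)) <= X * b ^ 2 + Y * a ^ 2).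
  { apply Rsqr_incr_0_var.
    - unfold Rsqr.
      assert (4 * (s ^ 2 * (a * b) ^ 2) <= 4 * (X * Y * (a * b) ^ 2)).
      { apply Rmult_le_compat_l; [lra|]. apply Rmult_le_compat_r; [apply pow2_ge_0|exact IH]. }
      generalize (pow2_ge_0 (X * b ^ 2 - Y * a ^ 2)); nra.
    - generalize (pow2_ge_0 a) (pow2_ge_0 b); nra. }
  replace ((s + a * b) ^ 2) with (s ^ 2 + 2 * (s * (a * b)) + (a * b) ^ 2) by ring.
  replace ((X + a ^ 2) * (Y + b ^ 2)) with (X * Y + (X * b ^ 2 + Y * a ^ 2) + (a * b) ^ 2) by ring.
  lra.
Qed.

Lemma csum_ext u v n : (forall k, (k < n)%nat -> u k = v k) -> csum u n = csum v n.
Proof.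
  induction n as [|n IH]; intros H; simpl; auto.
  rewrite IH, H; auto.
Qed.

Lemma csum_plus u v n : csum (fun k => u k + v k)%C n = (csum u n + csum v n)%C.
Proof. induction n as [|n IH]; simpl; [|rewrite IH]; ring. Qed.

Lemma csum_scal c u n : csum (fun k => c * u k)%C n = (c * csum u n)%C.
Proof. induction n as [|n IH]; simpl; [|rewrite IH]; ring. Qed.

Lemma csum_first u n : csum u (S n) = (u O + csum (fun k => u (S k)) n)%C.
Proof.
  induction n as [|n IH]; [simpl; ring|].
  change (csum u (S n) + u (S n) = u O + (csum (fun k => u (S k)) n + u (S n)))%C.
  rewrite IH; ring.
Qed.

Lemma csum_zero (u : nat -> C) n : (forall k, (k < n)%nat -> u k = 0%C) -> csum u n = 0%C.
Proof.
  induction n as [|n IH]; intros H; simpl; auto.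
  rewrite IH, H; auto; ring.
Qed.

Lemma csum_swap (u : nat -> nat -> C) m n :
  csum (fun i => csum (u i) n) m = csum (fun j => csum (fun i => u i j) m) n.
Proof.
  induction m as [|m IH]; simpl.
  - symmetry; apply csum_zero; auto.
  - rewrite IH, <- csum_plus; reflexivity.
Qed.

Lemma Cmod_csum_le u n : Cmod (csum u n) <= rsum (fun k => Cmod (u k)) n.
Proof.
  induction n as [|n IH]; simpl; [rewrite Cmod_0; lra|].
  eapply Rle_trans; [apply Cmod_triangle|lra].
Qed.

Lemma csum_sub_le u n m :
  (n <= m)%nat ->
  Cmod (csum u m - csum u n) <= rsum (fun k => Cmod (u k)) m - rsum (fun k => Cmod (u k)) n.
Proof.
  induction 1 as [|m _ IH]; simpl.
  - replace (csum u n - csum u n)%C with (RtoC 0) by ring. rewrite Cmod_0; lra.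
  - replace (csum u m + u m - csum u n)%C with ((csum u m - csum u n) + u m)%C by ring.
    eapply Rle_trans; [apply Cmod_triangle|lra].
Qed.

Lemma Re_csum u n : Re (csum u n) = rsum (fun k => Re (u k)) n.
Proof. induction n as [|n IH]; simpl; [|rewrite <- IH]; reflexivity. Qed.

Lemma Im_csum u n : Im (csum u n) = rsum (fun k => Im (u k)) n.
Proof. induction n as [|n IH]; simpl; [|rewrite <- IH]; reflexivity. Qed.

(** * Complex series and power series *)

(** An epsilon form of complex convergence in which [csum u n] stops before index [n]; [sum_n]
    includes that index, hence the shifts by one in the translations below. *)
Definition cseries (u : nat -> C) (l : C) : Prop :=
  forall eps, 0 < eps -> exists N, forall n, (N <= n)%nat -> Cmod (csum u n - l) < eps.

Lemma sum_n_csum (u : nat -> C) n : sum_n u n = csum u (S n).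
Proof.
  induction n as [|n IH].
  - rewrite sum_O. simpl. ring.
  - rewrite sum_Sn, IH. reflexivity.
Qed.

Lemma sum_n_rsum (u : nat -> R) n : sum_n u n = rsum u (S n).
Proof.
  induction n as [|n IH].
  - rewrite sum_O. simpl. ring.
  - rewrite sum_Sn, IH. reflexivity.
Qed.

Lemma is_series_cseries (u : nat -> C) l :
  @is_series C_AbsRing C_NormedModule u l <-> cseries u l.
Proof.
  unfold is_series.
  rewrite (@filterlim_locally_ball_norm C_AbsRing nat C_NormedModule _ _ (sum_n u) l).
  split.
  - intros H eps Heps. destruct (H (mkposreal eps Heps)) as [N HN].
    exists (S N). intros [|n] Hn; [lia|].
    assert (Hn' : (N <= n)%nat) by lia.
    specialize (HN n Hn'). unfold ball_norm in HN. cbn [pos] in HN.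
    rewrite sum_n_csum in HN. exact HN.
  - intros H eps. destruct (H eps (cond_pos eps)) as [N HN].
    exists N. intros n Hn. unfold ball_norm.
    rewrite sum_n_csum. apply HN; lia.
Qed.

Lemma is_series_rsum (u : nat -> R) l :
  is_series u l <->
  forall eps, 0 < eps -> exists N, forall n, (N <= n)%nat -> Rabs (rsum u n - l) < eps.
Proof.
  unfold is_series.
  rewrite (@filterlim_locally_ball_norm R_AbsRing nat R_NormedModule _ _ (sum_n u) l).
  split.
  - intros H eps Heps. destruct (H (mkposreal eps Heps)) as [N HN].
    exists (S N). intros [|n] Hn; [lia|].
    assert (Hn' : (N <= n)%nat) by lia.
    specialize (HN n Hn'). unfold ball_norm in HN. cbn [pos] in HN.
    rewrite sum_n_rsum in HN. exact HN.
  - intros H eps. destruct (H eps (cond_pos eps)) as [N HN].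
    exists N. intros n Hn. unfold ball_norm.
    rewrite sum_n_rsum. apply HN; lia.
Qed.

Lemma im_le_Cmod c : Rabs (Im c) <= Cmod c.
Proof. eapply Rle_trans; [apply Rmax_r|apply Rmax_Cmod]. Qed.

Lemma Cmod_le_Re_Im c : Cmod c <= Rabs (Re c) + Rabs (Im c).
Proof.
  replace c with (RtoC (Re c) + Ci * RtoC (Im c))%C at 1
    by (destruct c; unfold RtoC, Ci, Cplus, Cmult; simpl; f_equal; ring).
  eapply Rle_trans; [apply Cmod_triangle|].
  rewrite Cmod_mult, Cmod_Ci, !Cmod_R; lra.
Qed.

(** This transfers theorems on real series, notably the Cauchy product, to complex ones. *)
Lemma cseries_Re_Im u l :
  cseries u l <-> is_series (fun n => Re (u n)) (Re l) /\ is_series (fun n => Im (u n)) (Im l).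
Proof.
  rewrite !is_series_rsum. split.
  - intros H; split; intros eps Heps; destruct (H eps Heps) as [N HN];
      exists N; intros n Hn; specialize (HN n Hn);
      [rewrite <- Re_csum|rewrite <- Im_csum].
    + generalize (re_le_Cmod (csum u n - l)%C). simpl. unfold Re in *; simpl; unfold Rminus; lra.
    + generalize (im_le_Cmod (csum u n - l)%C). simpl. unfold Im in *; simpl; unfold Rminus; lra.
  - intros [H1 H2] eps Heps.
    destruct (H1 (eps / 2)) as [N1 HN1]; [lra|].
    destruct (H2 (eps / 2)) as [N2 HN2]; [lra|].
    exists (max N1 N2); intros n Hn.
    assert (Hn1 : (N1 <= n)%nat) by lia. assert (Hn2 : (N2 <= n)%nat) by lia.
    specialize (HN1 n Hn1). specialize (HN2 n Hn2).
    rewrite <- Re_csum in HN1; rewrite <- Im_csum in HN2.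
    eapply Rle_lt_trans; [apply Cmod_le_Re_Im|].
    change (Re (csum u n - l)%C) with (Re (csum u n) - Re l).
    change (Im (csum u n - l)%C) with (Im (csum u n) - Im l).
    lra.
Qed.

Lemma rsum_cv_le u l B : is_series u l -> (forall n, rsum u n <= B) -> l <= B.
Proof.
  rewrite is_series_rsum. intros H HB.
  apply Rnot_lt_le; intros Hlt.
  destruct (H (l - B)) as [N HN]; [lra|].
  specialize (HN N (le_n _)). specialize (HB N). apply Rabs_def2 in HN. lra.
Qed.

Lemma rsum_le_series u l n : (forall k, 0 <= u k) -> is_series u l -> rsum u n <= l.
Proof.
  rewrite is_series_rsum. intros Hu H.
  apply Rnot_lt_le; intros Hlt.
  destruct (H (rsum u n - l)) as [N HN]; [lra|].
  specialize (HN (max N n) (Nat.le_max_l _ _)).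
  generalize (rsum_mono u n (max N n) Hu (Nat.le_max_r _ _)).
  apply Rabs_def2 in HN. lra.
Qed.

Lemma ex_series_bounded u B :
  (forall k, 0 <= u k) -> (forall n, rsum u n <= B) -> ex_series u.
Proof.
  intros Hu HB.
  destruct (ex_finite_lim_seq_incr (sum_n u) B) as [l Hl].
  - intros n. rewrite !sum_n_rsum. apply rsum_mono; auto.
  - intros n. rewrite sum_n_rsum. apply HB.
  - exists l. exact Hl.
Qed.

Lemma ex_cseries u v :
  (forall n, Cmod (u n) <= v n) -> ex_series v -> exists l, cseries u l.
Proof.
  intros H Hv.
  destruct (@ex_series_le C_AbsRing C_CompleteNormedModule u v H Hv) as [l Hl].
  exists l. apply is_series_cseries. exact Hl.
Qed.

Definition pev (a : nat -> C) (n : nat) (z : C) : C := csum (fun k => a k * z ^ k)%C n.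

Lemma pow_n_Cpow (z : C) k : @pow_n C_Ring z k = (z ^ k)%C.
Proof. induction k as [|k IH]; [reflexivity|]. simpl. rewrite IH. reflexivity. Qed.

Lemma is_pseries_iff a (z l : C) :
  @is_pseries C_AbsRing C_NormedModule a z l <-> cseries (fun k => a k * z ^ k)%C l.
Proof.
  unfold is_pseries. rewrite is_series_cseries.
  assert (E : forall k, @scal C_Ring C_ModuleSpace (@pow_n C_Ring z k) (a k) = (a k * z ^ k)%C).
  { intros k. rewrite pow_n_Cpow. apply Cmult_comm. }
  split; intros H eps Heps; destruct (H eps Heps) as [N HN]; exists N; intros n Hn;
    specialize (HN n Hn).
  - erewrite csum_ext; [exact HN|]. intros k _; symmetry; apply E.
  - erewrite csum_ext; [exact HN|]. intros k _; apply E.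
Qed.

Lemma pev_S a n z : pev a (S n) z = (a O + z * pev (fun k => a (S k)) n z)%C.
Proof.
  unfold pev. rewrite csum_first, <- csum_scal.
  f_equal; [simpl; ring|]. apply csum_ext; intros k _. rewrite Cpow_S. ring.
Qed.

(** A function is always carried together with explicit coefficients, so that products, powers and
    composites come with formulas for theirs. *)
Definition represents (b : nat -> C) (F : C -> C) : Prop :=
  forall z, in_disk z -> @is_pseries C_AbsRing C_NormedModule b z (F z).

Lemma cseries_terms_bounded u l : cseries u l -> exists B, forall n, Cmod (u n) <= B.
Proof.
  intros H. destruct (H 1) as [N HN]; [lra|].
  exists (2 + rsum (fun k => Cmod (u k)) N). intros n.
  assert (H0 : forall k, 0 <= Cmod (u k)) by (intros; apply Cmod_ge_0).
  destruct (Nat.lt_ge_cases n N) as [Hn|Hn].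
  - generalize (rsum_term_le (fun k => Cmod (u k)) N n H0 Hn). lra.
  - generalize (HN n Hn) (HN (S n) (Nat.le_le_succ_r _ _ Hn)) (rsum_nonneg _ N H0). simpl.
    intros H1 H2 H3.
    replace (u n) with ((csum u n + u n - l) + - (csum u n - l))%C by ring.
    eapply Rle_trans; [apply Cmod_triangle|]. rewrite Cmod_opp. lra.
Qed.

(** Convergence at the real point [s] makes the terms there bounded, which gives a Cauchy-type
    estimate without contour integrals. *)
Lemma represents_coef_bound b F s :
  represents b F -> 0 < s < 1 -> exists B, 0 <= B /\ forall n, Cmod (b n) * s ^ n <= B.
Proof.
  intros H Hs.
  assert (Hd : in_disk (RtoC s)) by (unfold in_disk; rewrite Cmod_R, Rabs_pos_eq; lra).
  specialize (H _ Hd). rewrite is_pseries_iff in H.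
  destruct (cseries_terms_bounded _ _ H) as [B HB].
  assert (HB' : forall n, Cmod (b n) * s ^ n <= B).
  { intros n. generalize (HB n). rewrite Cmod_mult, Cmod_pow, Cmod_R, Rabs_pos_eq; lra. }
  exists B; split; auto.
  apply Rle_trans with (2 := HB' O). simpl. generalize (Cmod_ge_0 (b O)); lra.
Qed.

Lemma coef_bound_term b s B r z n :
  0 < s -> (forall n, Cmod (b n) * s ^ n <= B) -> Cmod z <= r ->
  Cmod (b n * z ^ n)%C <= B * (r / s) ^ n.
Proof.
  intros Hs HB Hz. rewrite Cmod_mult, Cmod_pow.
  assert (Hr : 0 <= r) by (generalize (Cmod_ge_0 z); lra).
  apply Rle_trans with (Cmod (b n) * r ^ n).
  - apply Rmult_le_compat_l; [apply Cmod_ge_0|]. apply pow_incr; split; [apply Cmod_ge_0|auto].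
  - replace (Cmod (b n) * r ^ n) with ((Cmod (b n) * s ^ n) * (r / s) ^ n).
    + apply Rmult_le_compat_r; auto. apply pow_le. apply Rdiv_le_0_compat; auto.
    + rewrite Rmult_assoc, <- Rpow_mult_distr. do 2 f_equal. field. lra.
Qed.

Lemma ex_series_scal_geom B q : 0 <= q < 1 -> ex_series (fun n => B * q ^ n).
Proof.
  intros Hq. apply (@ex_series_scal R_AbsRing R_NormedModule B (fun n => q ^ n)).
  apply ex_series_geom. rewrite Rabs_pos_eq; lra.
Qed.

Lemma coef_bound_ex_series b s B z :
  0 < s -> (forall n, Cmod (b n) * s ^ n <= B) -> Cmod z < s ->
  ex_series (fun n => Cmod (b n * z ^ n)%C).
Proof.
  intros Hs HB Hz.
  apply (@ex_series_le R_AbsRing R_CompleteNormedModule _ (fun n => B * (Cmod z / s) ^ n)).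
  - intros n. change (norm (Cmod (b n * z ^ n)%C)) with (Rabs (Cmod (b n * z ^ n)%C)).
    rewrite Rabs_pos_eq by apply Cmod_ge_0.
    apply coef_bound_term; auto; lra.
  - apply ex_series_scal_geom. split.
    + apply Rdiv_le_0_compat; [apply Cmod_ge_0|auto].
    + apply Rlt_div_l; lra.
Qed.

(** On [Cmod z <= r] the terms are dominated by [B * (r / s) ^ n]. The block from [T] to a large [m]
    is bounded by a geometric sum, and the partial sum at [m] is as close to [l] as desired. *)
Lemma pev_tail b s B r z l T :
  0 < s -> (forall n, Cmod (b n) * s ^ n <= B) -> r < s -> Cmod z <= r ->
  @is_pseries C_AbsRing C_NormedModule b z l ->
  Cmod (l - pev b T z)%C <= B * (r / s) ^ T / (1 - r / s).
Proof.
  intros Hs HB Hr Hz Hl. rewrite is_pseries_iff in Hl.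
  assert (Hr0 : 0 <= r) by (generalize (Cmod_ge_0 z); lra).
  assert (HB0 : 0 <= B).
  { apply Rle_trans with (2 := HB O). simpl. generalize (Cmod_ge_0 (b O)); lra. }
  assert (Hq : 0 <= r / s < 1).
  { split; [apply Rdiv_le_0_compat; auto|]. apply Rlt_div_l; lra. }
  set (q := r / s) in *.
  apply le_epsilon; intros eps Heps.
  destruct (Hl eps Heps) as [N HN].
  specialize (HN (max N T) (Nat.le_max_l _ _)).
  generalize (csum_sub_le (fun k => b k * z ^ k)%C T (max N T) (Nat.le_max_r _ _)).
  set (m := max N T) in *. intros H1.
  assert (H2 : rsum (fun k => Cmod (b k * z ^ k)%C) m - rsum (fun k => Cmod (b k * z ^ k)%C) T
               <= B * q ^ T / (1 - q)).
  { replace m with (m - T + T)%nat by lia.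
    generalize (m - T)%nat; intros d.
    assert (G : rsum (fun k => Cmod (b k * z ^ k)%C) (d + T) -
                rsum (fun k => Cmod (b k * z ^ k)%C) T <= B * q ^ T * rsum (fun k => q ^ k) d).
    { induction d as [|d IH]; simpl; [lra|].
      generalize (coef_bound_term b s B r z (d + T) Hs HB Hz). fold q. rewrite pow_add.
      intros; lra. }
    apply Rle_trans with (1 := G).
    unfold Rdiv. apply Rmult_le_compat_l.
    - apply Rmult_le_pos; auto. apply pow_le; lra.
    - apply rsum_geom_le; auto. }
  unfold pev.
  replace (l - csum (fun k => b k * z ^ k) T)%C with
    (- (csum (fun k => b k * z ^ k) m - l) + (csum (fun k => b k * z ^ k) m - csum (fun k => b k * z ^ k) T))%C by ring.
  eapply Rle_trans; [apply Cmod_triangle|]. rewrite Cmod_opp. lra.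
Qed.

(** * Algebra of power series *)

Definition cauchy_prod (a b : nat -> C) (n : nat) : C := csum (fun k => a k * b (n - k)%nat)%C (S n).

Lemma sum_f_R0_rsum u n : sum_f_R0 u n = rsum u (S n).
Proof.
  induction n as [|n IH]; [simpl; ring|].
  change (sum_f_R0 u n + u (S n) = rsum u (S n) + u (S n)). rewrite IH; reflexivity.
Qed.

Lemma ex_series_Rabs_le (u v : nat -> R) :
  (forall n, Rabs (u n) <= v n) -> ex_series v -> ex_series (fun n => Rabs (u n)).
Proof.
  intros H Hv. apply (@ex_series_le R_AbsRing R_CompleteNormedModule _ v); auto.
  intros n. change (Rabs (Rabs (u n)) <= v n). rewrite Rabs_Rabsolu; auto.
Qed.

(** Four real Cauchy products, of the real and imaginary parts of both factors, are combined;
    absolute convergence passes to these parts from the moduli. *)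
Lemma cseries_mult u v l l' :
  cseries u l -> cseries v l' ->
  ex_series (fun n => Cmod (u n)) -> ex_series (fun n => Cmod (v n)) ->
  cseries (cauchy_prod u v) (l * l')%C.
Proof.
  rewrite !cseries_Re_Im. intros [Hu1 Hu2] [Hv1 Hv2] Hu Hv.
  assert (Au1 := ex_series_Rabs_le _ _ (fun n => re_le_Cmod (u n)) Hu).
  assert (Au2 := ex_series_Rabs_le _ _ (fun n => im_le_Cmod (u n)) Hu).
  assert (Av1 := ex_series_Rabs_le _ _ (fun n => re_le_Cmod (v n)) Hv).
  assert (Av2 := ex_series_Rabs_le _ _ (fun n => im_le_Cmod (v n)) Hv).
  assert (H11 := is_series_mult _ _ _ _ Hu1 Hv1 Au1 Av1).
  assert (H22 := is_series_mult _ _ _ _ Hu2 Hv2 Au2 Av2).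
  assert (H12 := is_series_mult _ _ _ _ Hu1 Hv2 Au1 Av2).
  assert (H21 := is_series_mult _ _ _ _ Hu2 Hv1 Au2 Av1).
  split.
  - eapply is_series_ext; [|exact (is_series_minus _ _ _ _ H11 H22)].
    intros n.
    change (sum_f_R0 (fun k => Re (u k) * Re (v (n - k)%nat)) n +
            - sum_f_R0 (fun k => Im (u k) * Im (v (n - k)%nat)) n = Re (cauchy_prod u v n)).
    rewrite !sum_f_R0_rsum. unfold cauchy_prod. rewrite Re_csum.
    replace (- rsum (fun k => Im (u k) * Im (v (n - k)%nat)) (S n)) with
      ((-1) * rsum (fun k => Im (u k) * Im (v (n - k)%nat)) (S n)) by ring.
    rewrite <- rsum_scal, <- rsum_plus. apply rsum_ext; intros k _.
    unfold Re, Im, Cmult; simpl; ring.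
  - eapply is_series_ext; [|exact (is_series_plus _ _ _ _ H12 H21)].
    intros n.
    change (sum_f_R0 (fun k => Re (u k) * Im (v (n - k)%nat)) n +
            sum_f_R0 (fun k => Im (u k) * Re (v (n - k)%nat)) n = Im (cauchy_prod u v n)).
    rewrite !sum_f_R0_rsum. unfold cauchy_prod. rewrite Im_csum.
    rewrite <- rsum_plus. apply rsum_ext; intros k _.
    unfold Re, Im, Cmult; simpl; ring.
Qed.

Lemma represents_ex_series b F z :
  represents b F -> in_disk z -> ex_series (fun n => Cmod (b n * z ^ n)%C).
Proof.
  intros H Hz. unfold in_disk in Hz. generalize (Cmod_ge_0 z); intros Hz0.
  destruct (represents_coef_bound b F ((1 + Cmod z) / 2) H) as [B [_ HB]]; [lra|].
  apply (coef_bound_ex_series b ((1 + Cmod z) / 2) B); auto; lra.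
Qed.

Lemma represents_mult a b F G :
  represents a F -> represents b G -> represents (cauchy_prod a b) (fun z => F z * G z)%C.
Proof.
  intros Ha Hb z Hz. rewrite is_pseries_iff.
  assert (A := represents_ex_series _ _ _ Ha Hz).
  assert (B := represents_ex_series _ _ _ Hb Hz).
  specialize (Ha z Hz). specialize (Hb z Hz). rewrite is_pseries_iff in Ha, Hb.
  assert (H := cseries_mult _ _ _ _ Ha Hb A B).
  intros eps Heps; destruct (H eps Heps) as [N HN]; exists N; intros n Hn.
  specialize (HN n Hn). erewrite csum_ext; [exact HN|].
  intros k _; unfold cauchy_prod; cbv beta.
  rewrite Cmult_comm, <- csum_scal. apply csum_ext; intros j Hj.
  replace (z ^ k)%C with (z ^ j * z ^ (k - j))%C; [ring|].
  rewrite <- Cpow_add_r. f_equal; lia.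
Qed.

Lemma cseries_plus u v l l' :
  cseries u l -> cseries v l' -> cseries (fun n => u n + v n)%C (l + l')%C.
Proof.
  intros Hu Hv eps Heps.
  destruct (Hu (eps / 2)) as [N1 H1]; [lra|]. destruct (Hv (eps / 2)) as [N2 H2]; [lra|].
  exists (max N1 N2); intros n Hn.
  assert (Hn1 : (N1 <= n)%nat) by lia. assert (Hn2 : (N2 <= n)%nat) by lia.
  specialize (H1 n Hn1). specialize (H2 n Hn2).
  rewrite csum_plus.
  replace (csum u n + csum v n - (l + l'))%C with ((csum u n - l) + (csum v n - l'))%C by ring.
  eapply Rle_lt_trans; [apply Cmod_triangle|lra].
Qed.

Lemma cseries_ext u v l : (forall n, u n = v n) -> cseries u l -> cseries v l.
Proof.
  intros E H eps Heps. destruct (H eps Heps) as [N HN]; exists N; intros n Hn.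
  rewrite <- (csum_ext u v); auto.
Qed.

Lemma represents_plus a b F G :
  represents a F -> represents b G ->
  represents (fun n => a n + b n)%C (fun z => F z + G z)%C.
Proof.
  intros Ha Hb z Hz. specialize (Ha z Hz). specialize (Hb z Hz).
  rewrite is_pseries_iff in *.
  eapply cseries_ext; [|apply (cseries_plus _ _ _ _ Ha Hb)].
  intros n; simpl; ring.
Qed.

Definition cst_coef (c : C) (n : nat) : C := match n with O => c | S _ => 0%C end.

Lemma represents_cst c : represents (cst_coef c) (fun _ => c).
Proof.
  intros z _. rewrite is_pseries_iff. intros eps Heps.
  exists 1%nat; intros [|n] Hn; [lia|].
  rewrite csum_first, csum_zero; [|intros; simpl; ring].
  simpl. replace (c * 1 + 0 - c)%C with (RtoC 0) by ring. rewrite Cmod_0; auto.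
Qed.

Lemma represents_scal c a F : represents a F -> represents (fun n => c * a n)%C (fun z => c * F z)%C.
Proof.
  intros Ha z Hz. specialize (Ha z Hz). rewrite is_pseries_iff in *.
  intros eps Heps. generalize (Cmod_ge_0 c); intros Hc.
  destruct (Ha (eps / (Cmod c + 1))) as [N HN]; [apply Rdiv_lt_0_compat; lra|].
  exists N; intros n Hn. specialize (HN n Hn).
  replace (csum (fun k => c * a k * z ^ k) n - c * F z)%C with
    (c * (csum (fun k => a k * z ^ k) n - F z))%C.
  - rewrite Cmod_mult. 
    apply Rlt_div_r in HN; [|lra].
    generalize (Cmod_ge_0 (csum (fun k => a k * z ^ k) n - F z)%C); nra.
  - rewrite (csum_ext (fun k => c * a k * z ^ k)%C (fun k => c * (a k * z ^ k))%C)
      by (intros; ring).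
    rewrite csum_scal; ring.
Qed.

Lemma represents_at_0 b F : represents b F -> F 0%C = b O.
Proof.
  intros H. assert (H0 : in_disk 0%C) by (unfold in_disk; rewrite Cmod_0; lra).
  specialize (H _ H0). rewrite is_pseries_iff in H.
  assert (Cmod (b O - F 0)%C <= 0).
  { apply le_epsilon; intros eps Heps. destruct (H eps Heps) as [N HN].
    specialize (HN (S N) (Nat.le_succ_diag_r _)).
    rewrite csum_first, csum_zero in HN.
    - replace (b O * 0 ^ 0 + 0 - F 0)%C with (b O - F 0)%C in HN by (simpl; ring). lra.
    - intros k _. simpl; ring. }
  assert (Cmod (b O - F 0)%C = 0) by (generalize (Cmod_ge_0 (b O - F 0)%C); lra).
  apply Cmod_eq_0 in H2. replace (b O) with ((b O - F 0) + F 0)%C by ring. rewrite H2; ring.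
Qed.
(** * Square means on circles *)

Lemma Cmod2_plus x y :
  Cmod (x + y)%C ^ 2 = Cmod x ^ 2 + 2 * Re (Cconj x * y)%C + Cmod y ^ 2.
Proof.
  rewrite !Cmod2_alt. destruct x, y. unfold Re, Im, Cconj, Cmult, Cplus; simpl. ring.
Qed.

Lemma Re_le_Cmod c : Re c <= Cmod c.
Proof. eapply Rle_trans; [apply Rle_abs|apply re_le_Cmod]. Qed.

Definition cis (t : R) : C := (cos t, sin t).

Lemma Cmod_cis t : Cmod (cis t) = 1.
Proof.
  assert (H : Cmod (cis t) ^ 2 = 1).
  { rewrite Cmod2_alt. unfold cis; simpl. generalize (sin2_cos2 t). unfold Rsqr; lra. }
  generalize (Cmod_ge_0 (cis t)). nra.
Qed.

Lemma cis_pow t n : (cis t ^ n)%C = cis (INR n * t).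
Proof.
  induction n as [|n IH].
  - simpl. unfold cis. rewrite Rmult_0_l, cos_0, sin_0. reflexivity.
  - rewrite Cpow_S, IH, S_INR, Rmult_plus_distr_r, Rmult_1_l.
    unfold cis, Cmult; simpl. rewrite cos_plus, sin_plus. f_equal; ring.
Qed.

Lemma csum_geom (x : C) n : ((1 - x) * csum (fun j => x ^ j) n = 1 - x ^ n)%C.
Proof.
  induction n as [|n IH]; simpl; [ring|].
  rewrite Cmult_plus_distr_l, IH. ring.
Qed.

(** Averages over the [N]-th roots of unity replace integrals over circles: for polynomials of
    degree less than [N] the formulas below are exact. *)
Definition unity_root (N : nat) : C := cis (2 * PI / INR N).

Lemma unity_root_sum N m :
  (0 < m < N)%nat -> csum (fun j => (unity_root N ^ j) ^ m)%C N = 0%C.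
Proof.
  intros Hm.
  assert (HN : 0 < INR N) by (apply lt_0_INR; lia).
  set (x := (unity_root N ^ m)%C).
  assert (Hx : x <> 1%C).
  { intros E. unfold x, unity_root in E. rewrite cis_pow in E.
    apply (f_equal fst) in E. simpl in E.
    (* Half of the angle of [x]: if [x] were 1, then [cos (2 * u) = 1] would force [sin u = 0],
       although [u] lies strictly between 0 and [PI]. *)
    set (u := INR m * PI / INR N).
    replace (INR m * (2 * PI / INR N)) with (2 * u) in E by (unfold u; field; lra).
    rewrite cos_2a_sin in E.
    assert (0 < sin u).
    { assert (0 < INR m) by (apply lt_0_INR; lia).
      assert (INR m < INR N) by (apply lt_INR; lia).
      generalize PI_RGT_0; intros HPI.
      apply sin_gt_0; unfold u.
      - apply Rdiv_lt_0_compat; auto. nra.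
      - apply Rlt_div_l; auto. nra. }
    nra. }
  assert (HxN : (x ^ N)%C = 1%C).
  { unfold x. rewrite <- Cpow_mult_r, Nat.mul_comm, Cpow_mult_r.
    unfold unity_root. rewrite (cis_pow _ N).
    replace (INR N * (2 * PI / INR N)) with (2 * PI) by (field; lra).
    unfold cis. rewrite cos_2PI, sin_2PI. apply Cpow_1_l. }
  assert (G := csum_geom x N). rewrite HxN in G.
  rewrite (csum_ext _ (fun j => x ^ j)%C).
  - assert (H1 : (1 - x)%C <> 0%C).
    { intros E. apply Hx. replace x with (1 - (1 - x))%C by ring. rewrite E; ring. }
    replace (csum (fun j => x ^ j)%C N) with (/ (1 - x) * ((1 - x) * csum (fun j => x ^ j) N))%C
      by (field; auto).
    rewrite G. ring.
  - intros j _. unfold x. rewrite <- !Cpow_mult_r. f_equal; lia.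
Qed.

(** Only the powers from 1 to [n < N] of the root occur, and each of them sums to zero. *)
Lemma mean_mul_pev r a n N :
  (n < N)%nat ->
  csum (fun j => RtoC r * unity_root N ^ j * pev a n (RtoC r * unity_root N ^ j))%C N = 0%C.
Proof.
  intros Hn.
  rewrite (csum_ext _
    (fun j => csum (fun k => a k * RtoC r ^ S k * (unity_root N ^ j) ^ S k) n)%C).
  - rewrite csum_swap. apply csum_zero; intros k Hk.
    rewrite csum_scal, unity_root_sum by lia. ring.
  - intros j _. unfold pev. rewrite <- csum_scal. apply csum_ext; intros k _.
    rewrite Cpow_mult_l, !Cpow_S. ring.
Qed.

Lemma rsum_const c n : rsum (fun _ => c) n = INR n * c.
Proof. induction n as [|n IH]; [simpl; ring|]. cbn [rsum]. rewrite IH, S_INR; ring. Qed.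

Lemma Cmod_circle_point r N j : 0 <= r -> Cmod (RtoC r * unity_root N ^ j)%C = r.
Proof.
  intros Hr. unfold unity_root. rewrite Cmod_mult, Cmod_pow, Cmod_cis, pow1, Cmod_R, Rabs_pos_eq; lra.
Qed.

(** Induction peels off the constant term: in the expansion of the square of [a O + z * q], the
    cross term has mean zero by [mean_mul_pev], and the square of [z * q] contributes the factor
    [r ^ 2]. *)
Lemma discrete_parseval r a n N :
  0 <= r -> (n <= N)%nat ->
  rsum (fun j => Cmod (pev a n (RtoC r * unity_root N ^ j)%C) ^ 2) N =
  INR N * rsum (fun k => Cmod (a k) ^ 2 * (r ^ k) ^ 2) n.
Proof.
  intros Hr. revert a; induction n as [|n IH]; intros a Hn.
  - simpl. unfold pev; simpl. rewrite Cmod_0.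
    rewrite rsum_const. ring.
  - set (q := fun j => pev (fun k => a (S k)) n (RtoC r * unity_root N ^ j)%C).
    rewrite (rsum_ext _ (fun j => (Cmod (a O) ^ 2 + r ^ 2 * Cmod (q j) ^ 2) +
       2 * Re (Cconj (a O) * (RtoC r * unity_root N ^ j * q j))%C)).
    2:{ intros j _. rewrite pev_S, Cmod2_plus, (Cmod_mult (_ * _)%C), Cmod_circle_point by auto.
        fold (q j). ring. }
    rewrite rsum_plus, rsum_plus, rsum_const, rsum_scal, rsum_scal.
    rewrite <- (Re_csum (fun j => Cconj (a O) * (RtoC r * unity_root N ^ j * q j))%C).
    rewrite csum_scal. unfold q. rewrite mean_mul_pev by lia.
    rewrite IH by lia. rewrite rsum_first, Cmult_0_r.
    replace (Re 0%C) with 0 by reflexivity.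
    rewrite (rsum_ext (fun k => Cmod (a (S k)) ^ 2 * (r ^ S k) ^ 2)
      (fun k => r ^ 2 * (Cmod (a (S k)) ^ 2 * (r ^ k) ^ 2))) by (intros; simpl; ring).
    rewrite rsum_scal. simpl; ring.
Qed.

Lemma discrete_mean_Re r h n N :
  (0 < n <= N)%nat ->
  rsum (fun j => Re (pev h n (RtoC r * unity_root N ^ j)%C)) N = INR N * Re (h O).
Proof.
  intros Hn. rewrite <- Re_csum. destruct n as [|n]; [lia|].
  rewrite (csum_ext _ (fun j => h O + RtoC r * unity_root N ^ j *
    pev (fun k => h (S k)) n (RtoC r * unity_root N ^ j))%C).
  - rewrite csum_plus, mean_mul_pev by lia.
    rewrite Cplus_0_r, Re_csum, rsum_const. reflexivity.
  - intros j _. apply pev_S.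
Qed.

(** The pointwise bound is averaged over [T] equally spaced points, for which both Parseval's
    identity and the mean value property of [Re] are exact. *)
Lemma poly_square_mean_le f h T r e :
  (0 < T)%nat -> 0 <= r ->
  (forall z, Cmod z = r -> Cmod (pev f T z) ^ 2 <= Re (pev h T z) + e) ->
  rsum (fun k => Cmod (f k) ^ 2 * (r ^ k) ^ 2) T <= Re (h O) + e.
Proof.
  intros HT Hr H.
  assert (HN : 0 < INR T) by (apply lt_0_INR; lia).
  apply Rmult_le_reg_l with (INR T); auto.
  rewrite <- discrete_parseval by auto.
  rewrite Rmult_plus_distr_l, <- (discrete_mean_Re r h T T) by lia.
  rewrite <- rsum_const, <- rsum_plus.
  apply rsum_le; intros j _. apply H. apply Cmod_circle_point; auto.
Qed.

Lemma pow_eventually_small q B eps :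
  0 <= q < 1 -> 0 < eps -> exists N, forall n, (N <= n)%nat -> B * q ^ n < eps.
Proof.
  intros Hq Heps.
  destruct (pow_lt_1_zero q) with (y := eps / (Rabs B + 1)) as [N HN].
  - rewrite Rabs_pos_eq; lra.
  - apply Rdiv_lt_0_compat; auto. generalize (Rabs_pos B); lra.
  - exists N; intros n Hn. specialize (HN n Hn).
    generalize (Rabs_pos B) (Rle_abs B) (pow_le q n (proj1 Hq)); intros H1 H2 H3.
    rewrite Rabs_pos_eq in HN by auto.
    apply Rlt_div_r in HN; [|lra]. nra.
Qed.

(** Both series are truncated at a common large [T], and the polynomial case is applied with the
    truncation error as slack. *)
Lemma square_mean_le_circle f h F H K r :
  represents f F -> represents h H ->
  (forall z, in_disk z -> Cmod (F z) ^ 2 <= Re (H z)) ->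
  0 < r < 1 ->
  rsum (fun k => Cmod (f k) ^ 2 * (r ^ k) ^ 2) K <= Re (h O).
Proof.
  intros Hf Hh HFH Hr.
  destruct (represents_coef_bound f F ((1 + r) / 2) Hf) as [B1 [HB1 Hf']]; [lra|].
  destruct (represents_coef_bound h H ((1 + r) / 2) Hh) as [B2 [HB2 Hh']]; [lra|].
  set (s := (1 + r) / 2) in *.
  assert (Hs : r < s) by (unfold s; lra). assert (Hs0 : 0 < s) by lra.
  set (q := r / s).
  assert (Hq : 0 <= q < 1).
  { unfold q; split; [apply Rdiv_le_0_compat; lra|]. apply Rlt_div_l; lra. }
  set (B := B1 + B2).
  assert (Hq' : 0 < / (1 - q)) by (apply Rinv_0_lt_compat; lra).
  set (D := B / (1 - q)).
  assert (HD : 0 <= D) by (unfold D; apply Rdiv_le_0_compat; unfold B; lra).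
  assert (tail : forall b G z T, represents b G -> (forall n, Cmod (b n) * s ^ n <= B) ->
    Cmod z = r -> Cmod (G z - pev b T z)%C <= D * q ^ T).
  { intros b G z T HG HB Hz.
    replace (D * q ^ T) with (B * (r / s) ^ T / (1 - r / s)).
    - apply pev_tail; auto; [lra|]. apply HG. unfold in_disk; lra.
    - unfold D. fold q. unfold Rdiv; ring. }
  assert (Hf2 : forall n, Cmod (f n) * s ^ n <= B) by (intros n; specialize (Hf' n); unfold B; lra).
  assert (Hh2 : forall n, Cmod (h n) * s ^ n <= B) by (intros n; specialize (Hh' n); unfold B; lra).
  apply le_epsilon; intros eps Heps.
  (* With [x = q ^ T <= 1] and [F0 <= D], squaring [F0 + D * x] costs at most [3 * D * D * x], and
     truncating [H] costs [D * x]. *)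
  destruct (pow_eventually_small q (3 * D * D + D) eps Hq Heps) as [N HN].
  set (T := (S (max N K))).
  assert (HT : (N <= T)%nat) by (unfold T; lia). specialize (HN T HT).
  apply Rle_trans with (rsum (fun k => Cmod (f k) ^ 2 * (r ^ k) ^ 2) T).
  { apply rsum_mono; [|unfold T; lia].
    intros k; apply Rmult_le_pos; apply pow2_ge_0. }
  apply poly_square_mean_le; [unfold T; lia|lra|].
  intros z Hz.
  assert (Hd : in_disk z) by (unfold in_disk; lra).
  (* The tail bound at [T = 0] says that [Cmod (F z) <= D]. *)
  generalize (tail f F z T Hf Hf2 Hz) (tail h H z T Hh Hh2 Hz) (tail f F z O Hf Hf2 Hz).
  intros T1 T2 T0.
  unfold pev at 1 in T0; simpl in T0.
  replace (F z - 0)%C with (F z) in T0 by ring. rewrite Rmult_1_r in T0.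
  specialize (HFH z Hd).
  assert (T3 : Cmod (pev f T z) <= Cmod (F z) + D * q ^ T).
  { replace (pev f T z) with (F z + - (F z - pev f T z))%C by ring.
    eapply Rle_trans; [apply Cmod_triangle|]. rewrite Cmod_opp; lra. }
  assert (T4 : Re (H z) <= Re (pev h T z) + D * q ^ T).
  { generalize (Re_le_Cmod (H z - pev h T z)%C).
    change (Re (H z - pev h T z)%C) with (Re (H z) - Re (pev h T z)). lra. }
  assert (Hqt : 0 <= q ^ T <= 1).
  { split; [apply pow_le; lra|]. rewrite <- (pow1 T). apply pow_incr; lra. }
  set (x := q ^ T) in *. set (F0 := Cmod (F z)) in *.
  assert (0 <= F0) by apply Cmod_ge_0.
  assert (HDx : 0 <= D * x) by (apply Rmult_le_pos; lra).
  assert (HDx1 : D * x <= D) by nra.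
  assert (Cmod (pev f T z) ^ 2 <= (F0 + D * x) ^ 2).
  { apply pow_incr; split; [apply Cmod_ge_0|auto]. }
  assert (F0 * (D * x) <= D * (D * x)) by (apply Rmult_le_compat_r; auto).
  assert (D * x * (D * x) <= D * (D * x)) by (apply Rmult_le_compat_r; auto).
  nra.
Qed.

Lemma one_minus_pow_ge e n : 0 <= e <= 1 -> 1 - INR n * e <= (1 - e) ^ n.
Proof.
  intros He; induction n as [|n IH]; [simpl; lra|].
  rewrite S_INR. simpl.
  apply Rle_trans with ((1 - e) * (1 - INR n * e)).
  - generalize (pos_INR n); nra.
  - apply Rmult_le_compat_l; lra.
Qed.

(** The radius [1 - e] tends to 1 in the circle estimate; the sum on the left is finite, so
    Bernoulli's inequality controls the loss. *)
Lemma square_mean_le f h F H K :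
  represents f F -> represents h H ->
  (forall z, in_disk z -> Cmod (F z) ^ 2 <= Re (H z)) ->
  rsum (fun k => Cmod (f k) ^ 2) K <= Re (h O).
Proof.
  intros Hf Hh HFH.
  set (S := rsum (fun k => Cmod (f k) ^ 2) K).
  assert (HS : 0 <= S) by (apply rsum_nonneg; intros; apply pow2_ge_0).
  apply le_epsilon; intros eps Heps.
  set (n := (2 * K)%nat).
  assert (Hn : 0 <= INR n) by apply pos_INR.
  assert (HnS : 0 <= INR n * S) by (apply Rmult_le_pos; auto).
  (* All exponents [2 * k] with [k < K] are at most [n], so the loss is at most
     [INR n * e * S <= eps]; the bound [/ 2] keeps the radius inside (0, 1). *)
  set (e := Rmin (/ 2) (eps / (INR n * S + 1))).
  assert (He : 0 < e <= / 2).
  { unfold e; split; [|apply Rmin_l]. apply Rmin_glb_lt; [lra|]. apply Rdiv_lt_0_compat; lra. }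
  assert (He2 : e * (INR n * S + 1) <= eps).
  { apply Rle_div_r; [lra|]. apply Rmin_r. }
  assert (G := square_mean_le_circle f h F H K (1 - e) Hf Hh HFH).
  apply Rle_trans with (rsum (fun k => Cmod (f k) ^ 2 * ((1 - e) ^ k) ^ 2) K + eps);
    [|apply Rplus_le_compat_r; apply G; lra].
  assert ((1 - INR n * e) * S <= rsum (fun k => Cmod (f k) ^ 2 * ((1 - e) ^ k) ^ 2) K).
  { unfold S. rewrite <- rsum_scal. apply rsum_le; intros k Hk.
    rewrite Rmult_comm. apply Rmult_le_compat_l; [apply pow2_ge_0|].
    rewrite <- pow_mult.
    eapply Rle_trans; [|apply one_minus_pow_ge; lra].
    assert (INR (k * 2) <= INR n) by (apply le_INR; unfold n; lia).
    nra. }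
  nra.
Qed.

(** * Subordination in the Hardy space *)

(* [Re (harm_maj p n w)] is the Poisson extension of [|p|^2] from the unit circle to [w];
   the recursion follows [p = p_0 + w q]. *)
Fixpoint harm_maj (p : nat -> C) (n : nat) (w : C) : C :=
  match n with
  | O => 0
  | S n => harm_maj (fun k => p (S k)) n w + RtoC (Cmod (p O) ^ 2) +
           2 * Cconj (p O) * (w * pev (fun k => p (S k)) n w)
  end%C.

Lemma Re_harm_maj_S p n w :
  Re (harm_maj p (S n) w) =
  Re (harm_maj (fun k => p (S k)) n w) + Cmod (p O) ^ 2 +
  2 * Re (Cconj (p O) * (w * pev (fun k => p (S k)) n w))%C.
Proof.
  cbn [harm_maj]. set (y := (w * _)%C). set (x := harm_maj _ _ _). set (u := Cmod _ ^ 2).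
  unfold Re; simpl. ring.
Qed.

(** Expanding the square of [p O + w * q] reproduces the recursion of [harm_maj], except that
    [w * q] stands where the induction hypothesis majorizes the larger modulus of [q]. *)
Lemma harm_maj_ge p n w : Cmod w <= 1 -> Cmod (pev p n w) ^ 2 <= Re (harm_maj p n w).
Proof.
  intros Hw; revert p; induction n as [|n IH]; intros p.
  - unfold pev; simpl. rewrite Cmod_0. lra.
  - rewrite Re_harm_maj_S, pev_S, Cmod2_plus, Cmod_mult.
    specialize (IH (fun k => p (S k))).
    assert ((Cmod w * Cmod (pev (fun k => p (S k)) n w)) ^ 2 <= Cmod (pev (fun k => p (S k)) n w) ^ 2).
    { apply pow_incr. generalize (Cmod_ge_0 w) (Cmod_ge_0 (pev (fun k => p (S k)) n w)). nra. }
    lra.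
Qed.

(* The summand [Cmod (pev p n w) ^ 2] makes the induction on [n] go through. *)
Lemma harm_maj_le p n w :
  Cmod w < 1 ->
  Re (harm_maj p n w) + Cmod (pev p n w) ^ 2 <=
  (2 + 4 / (1 - Cmod w ^ 2)) * rsum (fun k => Cmod (p k) ^ 2) n.
Proof.
  intros Hw; revert p; induction n as [|n IH]; intros p.
  - unfold pev; simpl. rewrite Cmod_0. lra.
  - rewrite Re_harm_maj_S, pev_S, Cmod2_plus, rsum_first, Rmult_plus_distr_l.
    specialize (IH (fun k => p (S k))).
    set (q := pev (fun k => p (S k)) n w) in *.
    generalize (Re_le_Cmod (Cconj (p O) * (w * q))%C).
    rewrite !Cmod_mult, Cmod_conj.
    generalize (Cmod_ge_0 w) (Cmod_ge_0 q) (Cmod_ge_0 (p O)).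
    set (t := Cmod w) in *. set (y := Cmod q) in *. set (x := Cmod (p O)).
    intros Ht Hy Hx HRe.
    assert (Ht2 : 0 < 1 - t ^ 2) by nra.
    (* The cross term occurs twice, once from each summand. Weighted AM-GM leaves exactly
       [(1 - t ^ 2) * y ^ 2], the amount by which [y ^ 2] in the induction hypothesis exceeds the
       new [t ^ 2 * y ^ 2]. *)
    assert (G : 4 * (x * (t * y)) <= 4 / (1 - t ^ 2) * x ^ 2 + (1 - t ^ 2) * y ^ 2).
    { set (d := 1 - t ^ 2) in *.
      assert (E : 4 / d * x ^ 2 + d * y ^ 2 - 4 * (x * y) = / d * (2 * x - d * y) ^ 2) by (field; lra).
      assert (0 <= / d * (2 * x - d * y) ^ 2).
      { apply Rmult_le_pos; [left; apply Rinv_0_lt_compat; auto|apply pow2_ge_0]. }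
      assert (x * (t * y) <= x * y) by (apply Rmult_le_compat_l; nra).
      lra. }
    nra.
Qed.

Fixpoint cauchy_pow (b : nat -> C) (n : nat) : nat -> C :=
  match n with O => cst_coef 1%C | S n => cauchy_prod b (cauchy_pow b n) end.

Lemma represents_ext b F G : (forall z, F z = G z) -> represents b F -> represents b G.
Proof. intros E H z Hz. rewrite <- E. auto. Qed.

Lemma represents_pow b F n : represents b F -> represents (cauchy_pow b n) (fun z => F z ^ n)%C.
Proof.
  intros H; induction n as [|n IH]; simpl.
  - apply represents_cst.
  - apply represents_mult; auto.
Qed.

(* Taylor coefficients of [pev a L o F], where [F] has coefficients [b]. *)
Definition comp_coef (b a : nat -> C) (L m : nat) : C :=
  csum (fun n => a n * cauchy_pow b n m)%C L.

Lemma represents_comp b F a L :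
  represents b F -> represents (comp_coef b a L) (fun z => pev a L (F z)).
Proof.
  intros H; induction L as [|L IH].
  - apply represents_ext with (fun _ => 0%C); [reflexivity|].
    assert (G := represents_cst 0%C). intros z Hz. specialize (G z Hz).
    rewrite is_pseries_iff in *. revert G. apply cseries_ext. intros [|n]; reflexivity.
  - apply (represents_plus (comp_coef b a L) (fun m => a L * cauchy_pow b L m)%C); auto.
    apply represents_scal, represents_pow; auto.
Qed.

(** [harm_maj p n] is a polynomial in [w], so composing it with [F] yields a power series to which
    [square_mean_le] applies. *)
Lemma represents_harm_maj b F p n :
  represents b F -> exists h, represents h (fun z => harm_maj p n (F z)).
Proof.
  intros H; revert p; induction n as [|n IH]; intros p; simpl.
  - exists (cst_coef 0%C). apply represents_cst.
  - destruct (IH (fun k => p (S k))) as [h Hh].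
    eexists. apply represents_plus.
    + apply represents_plus; [exact Hh|apply represents_cst].
    + apply represents_mult; [apply represents_cst|].
      apply represents_mult; [exact H|]. apply represents_comp; exact H.
Qed.

(** Littlewood's subordination: the mean of the majorant composed with [phi] is its value at 0, that
    is [harm_maj a L] at [phi 0 = b O], where [harm_maj_le] bounds it. *)
Lemma comp_coef_l2_bound b phi a L K :
  represents b phi -> (forall z, in_disk z -> in_disk (phi z)) ->
  rsum (fun m => Cmod (comp_coef b a L m) ^ 2) K <=
  (2 + 4 / (1 - Cmod (b O) ^ 2)) * rsum (fun n => Cmod (a n) ^ 2) L.
Proof.
  intros Hb Hphi.
  destruct (represents_harm_maj b phi a L Hb) as [h Hh].
  assert (H0 : in_disk 0%C) by (unfold in_disk; rewrite Cmod_0; lra).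
  rewrite <- (represents_at_0 b phi Hb).
  apply Rle_trans with (Re (h O)).
  - apply (square_mean_le _ h (fun z => pev a L (phi z)) (fun z => harm_maj a L (phi z))); auto.
    + apply represents_comp; auto.
    + intros z Hz. apply harm_maj_ge. left; apply Hphi; auto.
  - rewrite <- (represents_at_0 h _ Hh).
    generalize (harm_maj_le a L (phi 0%C) (Hphi _ H0)) (pow2_ge_0 (Cmod (pev a L (phi 0%C)))).
    lra.
Qed.

(** * Decay of the coefficients of powers of the symbol *)

Lemma represents_dilate b F r :
  0 < r <= 1 -> represents b F ->
  represents (fun m => b m * RtoC r ^ m)%C (fun z => F (RtoC r * z)%C).
Proof.
  intros Hr H z Hz. rewrite is_pseries_iff.
  assert (Hd : in_disk (RtoC r * z)%C).
  { unfold in_disk in *. rewrite Cmod_mult, Cmod_R, Rabs_pos_eq by lra.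
    generalize (Cmod_ge_0 z); nra. }
  specialize (H _ Hd). rewrite is_pseries_iff in H.
  revert H; apply cseries_ext. intros n. rewrite Cpow_mult_l. ring.
Qed.

Lemma symbol_small_near_0 b phi :
  represents b phi -> (forall z, in_disk z -> in_disk (phi z)) ->
  exists r rho, 0 < r < 1 /\ 0 < rho < 1 /\ forall z, Cmod z <= r -> Cmod (phi z) <= rho.
Proof.
  intros Hb Hphi.
  destruct (represents_coef_bound b phi (/ 2) Hb) as [B [HB0 HB]]; [lra|].
  assert (H0 : in_disk 0%C) by (unfold in_disk; rewrite Cmod_0; lra).
  assert (Ha := Hphi _ H0). rewrite (represents_at_0 b phi Hb) in Ha. unfold in_disk in Ha.
  generalize (Cmod_ge_0 (b O)); intros Ha0.
  set (A := Cmod (b O)) in *.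
  (* The factor 8 gives [r <= / 8] and [4 * (r * B) <= (1 - A) / 2], so [phi] moves from [b O] by at
     most half of the distance from [A] to 1. *)
  set (r := (1 - A) / (8 * (B + 1))).
  assert (Hr : r * (8 * (B + 1)) = 1 - A) by (unfold r; field; lra).
  assert (Hr0 : 0 < r) by (unfold r; apply Rdiv_lt_0_compat; lra).
  assert (HrB : 0 <= r * B) by (apply Rmult_le_pos; lra).
  exists r, ((1 + A) / 2). repeat split; try lra.
  intros z Hz.
  assert (Hd : in_disk z) by (unfold in_disk; lra).
  assert (Hr2 : r < / 2) by lra.
  assert (H2 : 0 < / 2) by lra.
  generalize (pev_tail b (/ 2) B r z (phi z) 1 H2 HB Hr2 Hz (Hb z Hd)).
  unfold pev; simpl.
  replace (phi z - (0 + b O * 1))%C with (phi z - b O)%C by ring.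
  replace (r / / 2) with (2 * r) by field.
  intros T.
  assert (B * (2 * r * 1) / (1 - 2 * r) <= 4 * (r * B)).
  { apply Rle_div_l; [lra|]. nra. }
  replace (phi z) with ((phi z - b O) + b O)%C by ring.
  eapply Rle_trans; [apply Cmod_triangle|]. fold A. lra.
Qed.

(** A Cauchy estimate: the dilate of the [n]-th power of [phi] is bounded by [rho ^ n] on the disk,
    so [square_mean_le] with a constant majorant bounds each single coefficient. *)
Lemma cauchy_pow_bound b phi r rho n m :
  represents b phi -> 0 < r < 1 -> 0 < rho < 1 -> (forall z, Cmod z <= r -> Cmod (phi z) <= rho) ->
  Cmod (cauchy_pow b n m) * r ^ m <= rho ^ n.
Proof.
  intros Hb Hr Hrho Hphi.
  assert (Hr' : 0 < r <= 1) by lra.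
  assert (G := represents_dilate _ _ r Hr' (represents_pow b phi n Hb)).
  assert (S := square_mean_le _ _ _ _ (S m) G (represents_cst (RtoC ((rho ^ n) ^ 2)))).
  apply Rsqr_incr_0_var; [|apply pow_le; lra].
  rewrite !Rsqr_pow2.
  refine (Rle_trans _ _ _ _ (S _)).
  - eapply Rle_trans; [|apply (rsum_term_le _ _ m); [intros; apply pow2_ge_0|lia]].
    cbv beta. rewrite Cmod_mult, Cmod_pow, Cmod_R, Rabs_pos_eq; lra.
  - intros z Hz. change (Re (RtoC ((rho ^ n) ^ 2))) with ((rho ^ n) ^ 2).
    apply pow_incr; split; [apply Cmod_ge_0|].
    rewrite Cmod_pow. apply pow_incr; split; [apply Cmod_ge_0|].
    apply Hphi. unfold in_disk in Hz. rewrite Cmod_mult, Cmod_R, Rabs_pos_eq by lra.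
    generalize (Cmod_ge_0 z); nra.
Qed.

(** * Weighted estimates *)

Lemma rsum_diff_le u v n m :
  (n <= m)%nat -> (forall k, (n <= k < m)%nat -> u k <= v k) ->
  rsum u m - rsum u n <= rsum v m - rsum v n.
Proof.
  induction 1 as [|m Hm IH]; intros H; simpl; [lra|].
  assert (rsum u m - rsum u n <= rsum v m - rsum v n) by (apply IH; intros; apply H; lia).
  assert (u m <= v m) by (apply H; lia). lra.
Qed.

(** Summation by parts; the inequality [G] retains the boundary term [w K * (rsum y K - rsum x K)]
    so that the induction closes. *)
Lemma abel_domination w x y K :
  (forall n, 0 <= w n) -> (forall n, w (S n) <= w n) ->
  (forall k, rsum x k <= rsum y k) ->
  rsum (fun m => x m * w m) K <= rsum (fun m => y m * w m) K.
Proof.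
  intros Hw0 Hw H.
  assert (G : w K * (rsum y K - rsum x K) <=
              rsum (fun m => y m * w m) K - rsum (fun m => x m * w m) K).
  { induction K as [|K IH]; cbn [rsum]; [lra|].
    generalize (H (S K)) (Hw K) (Hw0 (S K)). cbn [rsum]. nra. }
  generalize (H K) (Hw0 K); nra.
Qed.

Lemma antitone_of_step w n m : (forall n, w (S n) <= w n) -> (n <= m)%nat -> w m <= w n.
Proof. intros H; induction 1 as [|m _ IH]; [lra|]. specialize (H m); lra. Qed.

Lemma doubling_pow w delta j n :
  0 <= delta -> (forall n, delta * w n <= w (2 * n)%nat) ->
  delta ^ j * w n <= w (2 ^ j * n)%nat.
Proof.
  intros Hd H; induction j as [|j IH].
  - rewrite Nat.pow_0_r, Nat.mul_1_l. simpl; lra.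
  - rewrite Nat.pow_succ_r', <- Nat.mul_assoc. simpl pow.
    eapply Rle_trans; [|apply H]. rewrite Rmult_assoc. apply Rmult_le_compat_l; auto.
Qed.

Lemma doubling_block w delta j :
  0 < delta -> (forall n, 0 < w n) -> (forall n, w (S n) <= w n) ->
  (forall n, delta * w n <= w (2 * n)%nat) ->
  exists D, 0 <= D /\ forall k n, (n < 2 ^ j * S k)%nat -> w k <= D * w n.
Proof.
  intros Hd Hw Hdec H2.
  (* For a positive index [k], [S j] doublings lead beyond [2 ^ j * (k + 1)], whence [D1]. Doubling
     0 leads nowhere, so [D2] compares [w O] directly with [w (2 ^ j)]. *)
  set (D1 := / delta ^ (S j)). set (D2 := w O / w (2 ^ j)%nat).
  assert (Hp : 0 < delta ^ S j) by (apply pow_lt; auto).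
  assert (HD1 : 0 < D1) by (apply Rinv_0_lt_compat; auto).
  assert (HD2 : 0 < D2) by (apply Rdiv_lt_0_compat; auto).
  exists (D1 + D2); split; [lra|]. intros k n Hn.
  generalize (Hw n) (Hw k); intros Hwn Hwk.
  destruct k as [|k].
  - assert (w (2 ^ j)%nat <= w n) by (apply antitone_of_step; auto; lia).
    assert (w O <= D2 * w n).
    { replace (w O) with (D2 * w (2 ^ j)%nat) by (unfold D2; field; apply Rgt_not_eq, Hw).
      apply Rmult_le_compat_l; lra. }
    nra.
  - assert (w (2 ^ S j * S k)%nat <= w n).
    { apply antitone_of_step; auto. rewrite Nat.pow_succ_r'. nia. }
    generalize (doubling_pow w delta (S j) (S k) (Rlt_le _ _ Hd) H2); intros G.
    assert (w (S k) <= D1 * w n).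
    { apply Rmult_le_reg_l with (delta ^ S j); auto.
      rewrite <- Rmult_assoc. unfold D1. rewrite Rinv_r by lra. lra. }
    nra.
Qed.

Lemma Cmod2_plus_le x y : Cmod (x + y)%C ^ 2 <= 2 * Cmod x ^ 2 + 2 * Cmod y ^ 2.
Proof.
  assert (H : Cmod (x + y)%C ^ 2 <= (Cmod x + Cmod y) ^ 2).
  { apply pow_incr; split; [apply Cmod_ge_0|apply Cmod_triangle]. }
  generalize (pow2_ge_0 (Cmod x - Cmod y)); nra.
Qed.

Lemma rsum_scal_r c u n : rsum (fun k => u k * c) n = rsum u n * c.
Proof. induction n as [|n IH]; simpl; [|rewrite IH]; ring. Qed.

(** The decay of the coefficients is given as the square of [sigma ^ n] so that one factor beats
    [r ^ m] beyond the cut at [A * k], while the other makes the weighted sum bounded by [V]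
    available to Cauchy-Schwarz. *)
Lemma comp_coef_weighted_bound b w r sigma A D V M0 :
  (forall n, 0 < w n) -> (forall n, w (S n) <= w n) ->
  0 < r -> 0 <= sigma <= 1 -> sigma ^ A <= r / 2 -> 0 <= D -> 0 <= M0 ->
  (forall k n, (n < A * S k)%nat -> w k <= D * w n) ->
  (forall L, rsum (fun n => (sigma ^ n) ^ 2 / w n) L <= V) ->
  (forall n m, Cmod (cauchy_pow b n m) * r ^ m <= (sigma ^ n) ^ 2) ->
  (forall a L K, rsum (fun m => Cmod (comp_coef b a L m) ^ 2) K <=
                 M0 * rsum (fun n => Cmod (a n) ^ 2) L) ->
  forall a L K,
    rsum (fun m => Cmod (comp_coef b a L m) ^ 2 * w m) K <=
    (2 * M0 * D + 4 * V * w O) * rsum (fun n => Cmod (a n) ^ 2 * w n) L.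
Proof.
  intros Hw Hdec Hr Hsig HsigA HD HM0 HwD HV Hcp Hl2 a L K.
  set (P := rsum (fun n => Cmod (a n) ^ 2)).
  set (Q := rsum (fun n => Cmod (a n) ^ 2 * w n)).
  set (S1 := rsum (fun n => Cmod (a n) * sigma ^ n)).
  assert (HS1pos : forall n, 0 <= Cmod (a n) * sigma ^ n).
  { intros n. apply Rmult_le_pos; [apply Cmod_ge_0|apply pow_le; lra]. }
  assert (HS0 : 0 <= S1 L) by (apply rsum_nonneg; auto).
  assert (HQ0 : 0 <= Q L).
  { apply rsum_nonneg; intros n. apply Rmult_le_pos; [apply pow2_ge_0|left; auto]. }
  (* Cauchy-Schwarz after inserting [sqrt (w n)] and its inverse. *)
  assert (HS : S1 L ^ 2 <= V * Q L).
  { unfold S1. rewrite (rsum_ext _ (fun n => (Cmod (a n) * sqrt (w n)) * (sigma ^ n / sqrt (w n)))).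
    - eapply Rle_trans; [apply rsum_cauchy_schwarz|]. rewrite Rmult_comm.
      apply Rmult_le_compat.
      + apply rsum_nonneg; intros; apply pow2_ge_0.
      + apply rsum_nonneg; intros; apply pow2_ge_0.
      + eapply Rle_trans; [|apply (HV L)]. right. apply rsum_ext; intros n _.
        unfold Rdiv. rewrite Rpow_mult_distr, pow_inv, pow2_sqrt; auto. left; auto.
      + right. apply rsum_ext; intros n _. rewrite Rpow_mult_distr, pow2_sqrt; auto. left; auto.
    - intros n _. field. apply Rgt_not_eq, sqrt_lt_R0, Hw. }
  set (cut := fun k => min L (A * k)).
  (* A telescoping comparison sequence for [abel_domination]. The whole tail error is charged to
     index 0, so after weighting it is multiplied by [w O] only. *)
  set (y := fun k => 2 * M0 * (P (cut (S k)) - P (cut k)) +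
                     match k with O => 4 * S1 L ^ 2 | S _ => 0 end).
  assert (HY : forall k, rsum y k = 2 * M0 * P (cut k) + match k with O => 0 | S _ => 4 * S1 L ^ 2 end).
  { induction k as [|k IH].
    - unfold cut. rewrite Nat.mul_0_r, Nat.min_0_r. unfold P; simpl; ring.
    - cbn [rsum]. rewrite IH. unfold y. destruct k; ring. }
  assert (HX : forall k, rsum (fun m => Cmod (comp_coef b a L m) ^ 2) k <= rsum y k).
  { intros k. rewrite HY. destruct k as [|k'].
    - unfold cut. rewrite Nat.mul_0_r, Nat.min_0_r. unfold P; simpl; lra.
    - set (k := S k').
      (* Beyond the cut, [n >= A * k >= A * m], so [sigma ^ n <= (r / 2) ^ m]: this absorbs [r ^ m]
         and leaves the summable factor [(/ 2) ^ m]. *)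
      assert (Ht : forall m, (m < k)%nat ->
        Cmod (comp_coef b a L m - comp_coef b a (cut k) m)%C <= (/ 2) ^ m * S1 L).
      { intros m Hm. unfold comp_coef.
        assert (Hcut : (cut k <= L)%nat) by (unfold cut; lia).
        eapply Rle_trans; [apply csum_sub_le; auto|].
        apply Rle_trans with
          (rsum (fun n => (/ 2) ^ m * (Cmod (a n) * sigma ^ n)) L -
           rsum (fun n => (/ 2) ^ m * (Cmod (a n) * sigma ^ n)) (cut k)).
        - apply rsum_diff_le; auto. intros n Hn.
          assert (Hn' : (A * m <= n)%nat) by (unfold cut in Hn; nia).
          rewrite Cmod_mult.
          assert (Hrm : 0 < r ^ m) by (apply pow_lt; auto).
          assert (Hs : sigma ^ n <= (/ 2) ^ m * r ^ m).
          { apply Rle_trans with (sigma ^ (A * m)).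
            - replace n with (A * m + (n - A * m))%nat by lia. rewrite pow_add.
              rewrite <- (Rmult_1_r (sigma ^ (A * m))) at 2.
              apply Rmult_le_compat_l; [apply pow_le; lra|].
              rewrite <- (pow1 (n - A * m)). apply pow_incr; lra.
            - rewrite pow_mult, <- Rpow_mult_distr. apply pow_incr. split.
              + apply pow_le; lra.
              + lra. }
          assert (Hc : Cmod (cauchy_pow b n m) <= (/ 2) ^ m * sigma ^ n).
          { apply Rmult_le_reg_r with (r ^ m); auto.
            eapply Rle_trans; [apply Hcp|].
            assert (0 <= sigma ^ n) by (apply pow_le; lra). nra. }
          generalize (Cmod_ge_0 (a n)); nra.
        - rewrite !rsum_scal. fold S1.
          generalize (rsum_nonneg _ (cut k) HS1pos). fold S1.
          assert (0 <= (/ 2) ^ m) by (apply pow_le; lra). nra. }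
      (* The geometric sum of ratio [/ 4] is at most 4/3, rounded up to 2. *)
      assert (Ht2 : rsum (fun m => Cmod (comp_coef b a L m - comp_coef b a (cut k) m)%C ^ 2) k
                    <= 2 * S1 L ^ 2).
      { apply Rle_trans with (rsum (fun m => (/ 4) ^ m * S1 L ^ 2) k).
        - apply rsum_le; intros m Hm.
          replace ((/ 4) ^ m * S1 L ^ 2) with (((/ 2) ^ m * S1 L) ^ 2).
          + apply pow_incr; split; [apply Cmod_ge_0|auto].
          + rewrite Rpow_mult_distr, <- pow_mult, Nat.mul_comm, pow_mult. do 2 f_equal. field.
        - rewrite rsum_scal_r. apply Rmult_le_compat_r; [apply pow2_ge_0|].
          eapply Rle_trans; [apply rsum_geom_le; lra|]. lra. }
      apply Rle_trans with
        (rsum (fun m => 2 * Cmod (comp_coef b a (cut k) m) ^ 2 +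
                        2 * Cmod (comp_coef b a L m - comp_coef b a (cut k) m)%C ^ 2) k).
      + apply rsum_le; intros m _.
        replace (comp_coef b a L m) with
          (comp_coef b a (cut k) m + (comp_coef b a L m - comp_coef b a (cut k) m))%C at 1 by ring.
        apply Cmod2_plus_le.
      + rewrite rsum_plus, !rsum_scal. specialize (Hl2 a (cut k) k). fold P in Hl2. lra. }
  assert (Hw0 : forall n, 0 <= w n) by (intros; left; auto).
  eapply Rle_trans; [apply (abel_domination w _ y K Hw0 Hdec HX)|].
  assert (HB : rsum (fun m => y m * w m) K <= 2 * M0 * D * Q (cut K) + 4 * S1 L ^ 2 * w O).
  { clear HX HY. destruct K as [|K].
    - unfold cut. rewrite Nat.mul_0_r, Nat.min_0_r. unfold Q; simpl.
      generalize (pow2_ge_0 (S1 L)) (Hw0 O). intros; nra.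
    (* Every [n] between the two cuts satisfies [n < A * S k], so [w k] may be replaced by [D * w n]
       term by term; the right-hand sides telescope to [Q]. *)
    - assert (Hstep : forall k, (P (cut (S k)) - P (cut k)) * w k <= D * (Q (cut (S k)) - Q (cut k))).
      { intros k. unfold P, Q. rewrite !Rmult_minus_distr_l, <- !rsum_scal.
        rewrite Rmult_minus_distr_r, <- !rsum_scal_r.
        apply rsum_diff_le; [unfold cut; nia|].
        intros n Hn. assert (w k <= D * w n) by (apply HwD; unfold cut in Hn; lia).
        generalize (pow2_ge_0 (Cmod (a n))); nra. }
      induction K as [|K IH].
      + specialize (Hstep O). assert (HQc : Q (cut O) = 0).
        { unfold cut. rewrite Nat.mul_0_r, Nat.min_0_r. reflexivity. }
        cbn [rsum]. unfold y. rewrite HQc in Hstep. nra.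
      + change (rsum (fun m => y m * w m) (S K) + y (S K) * w (S K) <=
          2 * M0 * D * Q (cut (S (S K))) + 4 * S1 L ^ 2 * w O).
        specialize (Hstep (S K)). unfold y at 2. nra. }
  assert (HQL : Q (cut K) <= Q L).
  { apply rsum_mono; [|unfold cut; lia].
    intros n. apply Rmult_le_pos; [apply pow2_ge_0|auto]. }
  assert (0 <= 2 * M0 * D) by nra.
  assert (2 * M0 * D * Q (cut K) <= 2 * M0 * D * Q L) by (apply Rmult_le_compat_l; auto).
  generalize (Hw0 O); nra.
Qed.

(** * Running minimum of the weight and the root condition *)

Fixpoint prefix_min (beta : nat -> R) (n : nat) : R :=
  match n with O => beta O | S n => Rmin (prefix_min beta n) (beta (S n)) end.

Lemma prefix_min_pos beta n : (forall n, 0 < beta n) -> 0 < prefix_min beta n.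
Proof. intros H; induction n as [|n IH]; simpl; auto. apply Rmin_glb_lt; auto. Qed.

Lemma prefix_min_step beta n : prefix_min beta (S n) <= prefix_min beta n.
Proof. apply Rmin_l. Qed.

Lemma prefix_min_le beta n : prefix_min beta n <= beta n.
Proof. destruct n; simpl; [lra|apply Rmin_r]. Qed.

(** Taken at [m = n] and combined with [prefix_min_le], this makes an essentially decreasing weight
    comparable to its largest decreasing minorant. *)
Lemma prefix_min_ge beta K n m :
  (forall m n, (n <= m)%nat -> beta m <= K * beta n) -> (n <= m)%nat ->
  beta m <= K * prefix_min beta n.
Proof.
  intros H; induction n as [|n IH]; intros Hm; simpl; auto.
  unfold Rmin; destruct Rle_dec; [apply IH|apply H]; lia.
Qed.

(** From some index on, the [n]-th root exceeds [tau]; the finitely many earlier positive values are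
    covered by shrinking [c]. *)
Lemma LimInf_root_lower_bound beta tau :
  (forall n, 0 < beta n) ->
  Rbar_le (Finite 1) (LimInf_seq (fun n => Rpower (beta n) (/ INR n))) ->
  0 < tau < 1 ->
  exists c, 0 < c /\ forall n, c * tau ^ n <= beta n.
Proof.
  intros Hb Hlim Htau.
  assert (Hev : exists N, forall n, (N <= n)%nat -> tau < Rpower (beta n) (/ INR n)).
  { destruct (ex_LimInf_seq (fun n => Rpower (beta n) (/ INR n))) as [l H].
    rewrite (is_LimInf_seq_unique _ _ H) in Hlim.
    destruct l as [l| |]; simpl in Hlim.
    - assert (He : 0 < 1 - tau) by lra.
      destruct (H (mkposreal _ He)) as [_ [N HN]]. exists N; intros n Hn.
      specialize (HN n Hn). simpl in HN. lra.
    - apply (H tau).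
    - easy. }
  destruct Hev as [N HN].
  assert (Hsmall : forall N, exists c, 0 < c <= 1 /\ forall n, (n < N)%nat -> c * tau ^ n <= beta n).
  { clear N HN. induction N as [|N [c [Hc IH]]].
    - exists 1; split; [lra|]. intros; lia.
    - assert (HtN : 0 < tau ^ N) by (apply pow_lt; lra).
      exists (Rmin c (beta N / tau ^ N)).
      assert (Hm := Rmin_l c (beta N / tau ^ N)).
      split; [split; [apply Rmin_glb_lt; [lra|apply Rdiv_lt_0_compat; auto]|lra]|].
      intros n Hn. destruct (Nat.eq_dec n N) as [->|Hne].
      + apply Rle_div_r; auto. apply Rmin_r.
      + assert (c * tau ^ n <= beta n) by (apply IH; lia).
        assert (0 < tau ^ n) by (apply pow_lt; lra). nra. }
  (* With [S N] in place of [N], the remaining indices are positive and [/ INR n] is a true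
     inverse. *)
  destruct (Hsmall (S N)) as [c [Hc Hc']].
  exists c; split; [lra|]. intros n.
  destruct (Nat.lt_ge_cases n (S N)) as [Hn|Hn]; [auto|].
  assert (Hn' : (N <= n)%nat) by lia. specialize (HN n Hn').
  assert (HnR : 0 < INR n) by (apply lt_0_INR; lia).
  assert (E : beta n = Rpower (beta n) (/ INR n) ^ n).
  { rewrite <- Rpower_pow by apply exp_pos.
    rewrite Rpower_mult, Rinv_l by lra. rewrite Rpower_1; auto. }
  assert (tau ^ n <= beta n) by (rewrite E; apply pow_incr; lra).
  assert (0 < tau ^ n) by (apply pow_lt; lra). nra.
Qed.

Lemma exists_pow_le q eps : 0 <= q < 1 -> 0 < eps -> exists N, forall n, (N <= n)%nat -> q ^ n <= eps.
Proof.
  intros Hq He. destruct (pow_eventually_small q 1 eps Hq He) as [N HN].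
  exists N; intros n Hn. specialize (HN n Hn). lra.
Qed.

Lemma comp_coef_beta_bound beta b phi :
  (forall n, 0 < beta n) ->
  ess_decreasing beta ->
  Rbar_le (Finite 1) (LimInf_seq (fun n => Rpower (beta n) (/ INR n))) ->
  Delta2 beta ->
  represents b phi -> (forall z, in_disk z -> in_disk (phi z)) ->
  exists M, 0 <= M /\ forall a L K,
    rsum (fun m => Cmod (comp_coef b a L m) ^ 2 * beta m) K <=
    M * rsum (fun n => Cmod (a n) ^ 2 * beta n) L.
Proof.
  intros Hbeta [C0 [HC0 Hess]] Hlim [delta [Hdelta Hd2]] Hb Hphi.
  set (w := prefix_min beta).
  assert (Hw : forall n, 0 < w n) by (intros; apply prefix_min_pos; auto).
  assert (Hdec : forall n, w (S n) <= w n) by apply prefix_min_step.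
  assert (Hwb : forall n, w n <= beta n) by apply prefix_min_le.
  assert (Hbw : forall n, beta n <= C0 * w n) by (intros; apply prefix_min_ge; auto).
  (* The doubling condition survives the passage to [w], with [C0] lost in comparing [beta (2 * n)]
     with [w (2 * n)]. *)
  assert (Hdw : forall n, delta / C0 * w n <= w (2 * n)%nat).
  { intros n. generalize (Hd2 n) (Hbw (2 * n)%nat) (Hwb n); intros H1 H2 H3.
    apply Rmult_le_reg_l with C0; [lra|].
    replace (C0 * (delta / C0 * w n)) with (delta * w n) by (field; lra). nra. }
  assert (Hdc : 0 < delta / C0) by (apply Rdiv_lt_0_compat; lra).
  destruct (symbol_small_near_0 b phi Hb Hphi) as [r [rho [Hr [Hrho Hsmall]]]].
  set (sigma := sqrt rho).
  assert (Hs2 : sigma ^ 2 = rho) by (apply pow2_sqrt; lra).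
  assert (Hs0 : 0 < sigma) by (apply sqrt_lt_R0; lra).
  assert (Hs : 0 < sigma < 1) by (split; nra).
  assert (Hr2 : 0 < r / 2) by lra.
  (* The cut factor [A] is taken to be [2 ^ j], which exceeds [j], so that [doubling_block] applies
     to it. *)
  destruct (exists_pow_le sigma (r / 2)) as [j Hj]; [lra|auto|].
  assert (HA : sigma ^ (2 ^ j) <= r / 2).
  { apply Hj. apply Nat.lt_le_incl, Nat.pow_gt_lin_r; lia. }
  destruct (doubling_block w (delta / C0) j Hdc Hw Hdec Hdw) as [D [HD HwD]].
  destruct (LimInf_root_lower_bound beta sigma Hbeta Hlim Hs) as [c [Hc Hlow]].
  (* From [c * sigma ^ n <= beta n <= C0 * w n], the quotient [(sigma ^ n) ^ 2 / w n] is at most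
     [C0 / c * sigma ^ n]. *)
  set (V := C0 / c * / (1 - sigma)).
  assert (HV : forall L, rsum (fun n => (sigma ^ n) ^ 2 / w n) L <= V).
  { intros L. apply Rle_trans with (rsum (fun n => C0 / c * sigma ^ n) L).
    - apply rsum_le; intros n _. apply Rle_div_l; [apply Hw|].
      assert (Hsn : 0 < sigma ^ n) by (apply pow_lt; lra).
      specialize (Hlow n). specialize (Hbw n).
      assert (G : sigma ^ n <= / c * (C0 * w n)).
      { apply Rmult_le_reg_l with c; auto.
        rewrite <- Rmult_assoc, Rinv_r, Rmult_1_l by lra. lra. }
      replace (C0 / c * sigma ^ n * w n) with (sigma ^ n * (/ c * (C0 * w n))) by (field; lra).
      replace ((sigma ^ n) ^ 2) with (sigma ^ n * sigma ^ n) by ring.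
      apply Rmult_le_compat_l; lra.
    - rewrite rsum_scal. apply Rmult_le_compat_l.
      + left; apply Rdiv_lt_0_compat; lra.
      + apply rsum_geom_le; lra. }
  set (M0 := 2 + 4 / (1 - Cmod (b O) ^ 2)).
  assert (HM0 : 0 <= M0).
  { assert (H0 : in_disk 0%C) by (unfold in_disk; rewrite Cmod_0; lra).
    assert (Ha := Hphi _ H0). rewrite (represents_at_0 b phi Hb) in Ha. unfold in_disk in Ha.
    generalize (Cmod_ge_0 (b O)); intros.
    assert (0 < 4 / (1 - Cmod (b O) ^ 2)) by (apply Rdiv_lt_0_compat; nra).
    unfold M0; lra. }
  set (M := 2 * M0 * D + 4 * V * w O).
  assert (HV0 : 0 <= V) by apply (HV O).
  assert (HM : 0 <= M).
  { unfold M. generalize (Hw O); intros.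
    assert (0 <= M0 * D) by (apply Rmult_le_pos; auto).
    assert (0 <= V * w O) by (apply Rmult_le_pos; lra). lra. }
  exists (C0 * M); split; [apply Rmult_le_pos; lra|].
  intros a L K.
  apply Rle_trans with (C0 * rsum (fun m => Cmod (comp_coef b a L m) ^ 2 * w m) K).
  { rewrite <- rsum_scal. apply rsum_le; intros m _.
    generalize (Hbw m) (pow2_ge_0 (Cmod (comp_coef b a L m))). nra. }
  rewrite Rmult_assoc. apply Rmult_le_compat_l; [lra|].
  apply Rle_trans with (M * rsum (fun n => Cmod (a n) ^ 2 * w n) L).
  - apply (comp_coef_weighted_bound b w r sigma (2 ^ j) D V M0); auto; try lra.
    + intros n m. rewrite <- pow_mult, Nat.mul_comm, pow_mult, Hs2.
      apply (cauchy_pow_bound b phi); auto.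
    + intros. apply (comp_coef_l2_bound b phi); auto.
  - apply Rmult_le_compat_l; auto. apply rsum_le; intros n _.
    apply Rmult_le_compat_l; [apply pow2_ge_0|auto].
Qed.

(** * Passage to the limit *)

Definition Cseries (u : nat -> C) : C := (Series (fun n => Re (u n)), Series (fun n => Im (u n))).

Lemma Cseries_correct u v :
  (forall n, Cmod (u n) <= v n) -> ex_series v -> cseries u (Cseries u).
Proof.
  intros H Hv. destruct (ex_cseries u v H Hv) as [l Hl].
  apply cseries_Re_Im in Hl. destruct Hl as [H1 H2].
  apply cseries_Re_Im; split; apply Series_correct; eexists; eauto.
Qed.

(** The lower bound on [beta] with [tau = s ^ 2] turns each term of the norm series into a multiple
    of the square of [Cmod (a n) * s ^ n]. *)
Lemma in_H2_coef_bound beta a s :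
  (forall n, 0 < beta n) ->
  Rbar_le (Finite 1) (LimInf_seq (fun n => Rpower (beta n) (/ INR n))) ->
  in_H2 beta a -> 0 < s < 1 -> exists B, forall n, Cmod (a n) * s ^ n <= B.
Proof.
  intros Hbeta Hlim Ha Hs.
  destruct (LimInf_root_lower_bound beta (s ^ 2) Hbeta Hlim) as [c [Hc Hlow]]; [nra|].
  set (N := H2_norm2 beta a).
  exists (sqrt (N / c)). intros n.
  rewrite <- (sqrt_Rsqr (Cmod (a n) * s ^ n)).
  2:{ apply Rmult_le_pos; [apply Cmod_ge_0|apply pow_le; lra]. }
  apply sqrt_le_1_alt. rewrite Rsqr_pow2.
  apply (proj1 (Rle_div_r _ _ c Hc)).
  assert (Hpos : forall k, 0 <= Cmod (a k) ^ 2 * beta k).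
  { intros k; apply Rmult_le_pos; [apply pow2_ge_0|left; auto]. }
  apply Rle_trans with (Cmod (a n) ^ 2 * beta n).
  - specialize (Hlow n). rewrite <- pow_mult, Nat.mul_comm, pow_mult in Hlow.
    rewrite Rpow_mult_distr, Rmult_assoc, (Rmult_comm ((s ^ n) ^ 2)).
    apply Rmult_le_compat_l; [apply pow2_ge_0|exact Hlow].
  - apply Rle_trans with (1 := rsum_term_le _ (S n) n Hpos (Nat.lt_succ_diag_r n)).
    apply rsum_le_series; auto. apply Series_correct; auto.
Qed.

Lemma Cmod_diff_abs_le x y : Rabs (Cmod x - Cmod y) <= Cmod (x - y)%C.
Proof.
  generalize (Cmod_triangle x (- (x - y))%C) (Cmod_triangle y (x - y)%C).
  rewrite Cmod_opp.
  replace (x + - (x - y))%C with y by ring. replace (y + (x - y))%C with x by ring.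
  intros; apply Rabs_le; lra.
Qed.

Lemma cseries_is_lim_seq_Cmod u l d :
  cseries u l -> is_lim_seq (fun n => Cmod (csum u n - d)%C) (Cmod (l - d)%C).
Proof.
  intros H. apply is_lim_seq_spec. intros eps.
  destruct (H eps (cond_pos eps)) as [N HN]. exists N; intros n Hn.
  eapply Rle_lt_trans; [apply Cmod_diff_abs_le|].
  replace (csum u n - d - (l - d))%C with (csum u n - l)%C by ring. auto.
Qed.

Lemma is_lim_seq_rsum (u : nat -> nat -> R) (v : nat -> R) K :
  (forall m, is_lim_seq (fun L => u L m) (v m)) ->
  is_lim_seq (fun L => rsum (u L) K) (rsum v K).
Proof.
  intros H; induction K as [|K IH]; simpl.
  - apply is_lim_seq_const.
  - apply (is_lim_seq_plus' _ _ _ _ IH (H K)).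
Qed.

(** A difference of truncations comes from the polynomial with its first [L0] coefficients removed,
    so the uniform estimate applies to differences too. *)
Lemma comp_coef_sub b a L L0 m :
  (L0 <= L)%nat ->
  comp_coef b (fun n => if Nat.ltb n L0 then 0%C else a n) L m =
  (comp_coef b a L m - comp_coef b a L0 m)%C.
Proof.
  unfold comp_coef. induction 1 as [|L HL IH].
  - rewrite csum_zero; [ring|]. intros k Hk. apply Nat.ltb_lt in Hk. rewrite Hk. ring.
  - cbn [csum]. rewrite IH. apply Nat.ltb_ge in HL. rewrite HL. ring.
Qed.

Lemma rsum_drop (a : nat -> C) (beta : nat -> R) L L0 :
  (L0 <= L)%nat ->
  rsum (fun n => Cmod (if Nat.ltb n L0 then 0%C else a n) ^ 2 * beta n) L =
  rsum (fun n => Cmod (a n) ^ 2 * beta n) L - rsum (fun n => Cmod (a n) ^ 2 * beta n) L0.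
Proof.
  induction 1 as [|L HL IH].
  - rewrite (rsum_ext _ (fun _ => 0)); [rewrite rsum_const; ring|].
    intros k Hk. apply Nat.ltb_lt in Hk. rewrite Hk, Cmod_0. ring.
  - cbn [rsum]. rewrite IH. apply Nat.ltb_ge in HL. rewrite HL. ring.
Qed.

(** With [K] fixed, [L] tends to infinity in the uniform estimate for the coefficients from [L0] on.
    [L0 = 0] gives the norm bound, and large [L0] gives approximation by polynomials. *)
Lemma comp_coef_limit_bound beta b a M c :
  (forall n, 0 < beta n) -> 0 <= M -> in_H2 beta a ->
  (forall a L K, rsum (fun m => Cmod (comp_coef b a L m) ^ 2 * beta m) K <=
                 M * rsum (fun n => Cmod (a n) ^ 2 * beta n) L) ->
  (forall m, cseries (fun n => a n * cauchy_pow b n m)%C (c m)) ->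
  forall L0 K,
    rsum (fun m => Cmod (c m - comp_coef b a L0 m)%C ^ 2 * beta m) K <=
    M * (H2_norm2 beta a - rsum (fun n => Cmod (a n) ^ 2 * beta n) L0).
Proof.
  intros Hbeta HM Ha Hfin Hc L0 K.
  assert (Hpos : forall k, 0 <= Cmod (a k) ^ 2 * beta k).
  { intros k; apply Rmult_le_pos; [apply pow2_ge_0|left; auto]. }
  assert (Hlim : is_lim_seq
    (fun L => rsum (fun m => Cmod (comp_coef b a L m - comp_coef b a L0 m)%C ^ 2 * beta m) K)
    (rsum (fun m => Cmod (c m - comp_coef b a L0 m)%C ^ 2 * beta m) K)).
  { apply is_lim_seq_rsum. intros m.
    assert (H := cseries_is_lim_seq_Cmod _ _ (comp_coef b a L0 m) (Hc m)).
    assert (H2 := is_lim_seq_mult' _ _ _ _ (is_lim_seq_mult' _ _ _ _ H H) (is_lim_seq_const (beta m))).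
    replace (Cmod (c m - comp_coef b a L0 m)%C ^ 2 * beta m) with
      (Cmod (c m - comp_coef b a L0 m)%C * Cmod (c m - comp_coef b a L0 m)%C * beta m) by ring.
    revert H2. apply is_lim_seq_ext; intros n. unfold comp_coef. ring. }
  refine (is_lim_seq_le_loc _ _ _ (Finite _) _ Hlim (is_lim_seq_const _)).
  exists L0; intros L HL.
  rewrite (rsum_ext _ (fun m =>
    Cmod (comp_coef b (fun n => if Nat.ltb n L0 then 0%C else a n) L m) ^ 2 * beta m)).
  - eapply Rle_trans; [apply Hfin|]. apply Rmult_le_compat_l; auto.
    rewrite rsum_drop by auto. apply Rplus_le_compat_r.
    apply rsum_le_series; auto. apply Series_correct; auto.
  - intros m _. rewrite comp_coef_sub; auto.
Qed.

(** Continuity of point evaluation, uniform in the length [K]: Cauchy-Schwarz reduces it to bounding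
    the sums of [(x ^ m) ^ 2 / beta m]. *)
Lemma pev_sq_le beta z :
  (forall n, 0 < beta n) ->
  Rbar_le (Finite 1) (LimInf_seq (fun n => Rpower (beta n) (/ INR n))) ->
  in_disk z ->
  exists W, 0 <= W /\ forall d K,
    Cmod (pev d K z) ^ 2 <= W * rsum (fun m => Cmod (d m) ^ 2 * beta m) K.
Proof.
  intros Hbeta Hlim Hz. unfold in_disk in Hz. generalize (Cmod_ge_0 z); intros Hz0.
  set (x := Cmod z) in *.
  destruct (LimInf_root_lower_bound beta ((1 + x) / 2) Hbeta Hlim) as [c [Hc Hlow]]; [lra|].
  set (tau := (1 + x) / 2) in *.
  assert (Htau : 0 < tau) by (unfold tau; lra).
  (* Since [x < 1], the midpoint [tau] of [x] and 1 exceeds [x ^ 2], so the ratio is below 1. *)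
  set (q := x ^ 2 / tau).
  assert (Hq : 0 <= q < 1).
  { unfold q; split; [apply Rdiv_le_0_compat; auto; apply pow2_ge_0|].
    apply Rlt_div_l; auto. unfold tau; nra. }
  exists (/ c * / (1 - q)). split.
  { apply Rmult_le_pos; left; apply Rinv_0_lt_compat; lra. }
  intros d K.
  apply Rle_trans with (rsum (fun m => (Cmod (d m) * sqrt (beta m)) * (x ^ m / sqrt (beta m))) K ^ 2).
  - apply pow_incr; split; [apply Cmod_ge_0|].
    eapply Rle_trans; [apply Cmod_csum_le|]. right. apply rsum_ext; intros m _.
    rewrite Cmod_mult, Cmod_pow. fold x. field. apply Rgt_not_eq, sqrt_lt_R0, Hbeta.
  - eapply Rle_trans; [apply rsum_cauchy_schwarz|]. rewrite Rmult_comm.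
    apply Rmult_le_compat.
    + apply rsum_nonneg; intros; apply pow2_ge_0.
    + apply rsum_nonneg; intros; apply pow2_ge_0.
    + apply Rle_trans with (rsum (fun m => / c * q ^ m) K).
      * apply rsum_le; intros m _.
        unfold Rdiv. rewrite Rpow_mult_distr, pow_inv, pow2_sqrt by (left; auto).
        apply Rle_div_l; [apply Hbeta|].
        assert (Ht : 0 < tau ^ m) by (apply pow_lt; auto).
        assert (Hx : 0 <= (x ^ m) ^ 2) by apply pow2_ge_0.
        replace (q ^ m) with ((x ^ m) ^ 2 * / tau ^ m).
        -- specialize (Hlow m).
           assert (G : 1 <= / c * / tau ^ m * beta m).
           { apply Rmult_le_reg_l with (c * tau ^ m); [apply Rmult_lt_0_compat; auto|].
             replace (c * tau ^ m * (/ c * / tau ^ m * beta m)) with (beta m) by (field; lra). lra. }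
           nra.
        -- unfold q, Rdiv. rewrite Rpow_mult_distr, pow_inv, <- !pow_mult.
           rewrite Nat.mul_comm. reflexivity.
      * rewrite rsum_scal. apply Rmult_le_compat_l; [left; apply Rinv_0_lt_compat; auto|].
        apply rsum_geom_le; auto.
    + right. apply rsum_ext; intros m _. rewrite Rpow_mult_distr, pow2_sqrt; auto. left; auto.
Qed.

Lemma pev_minus c d K z : pev (fun m => c m - d m)%C K z = (pev c K z - pev d K z)%C.
Proof. unfold pev; induction K as [|K IH]; simpl; [|rewrite IH]; ring. Qed.

Theorem mainTheorem7 (beta : nat -> R) :
  (forall n, 0 < beta n) ->
  ess_decreasing beta ->
  Rbar_le (Finite 1) (LimInf_seq (fun n => Rpower (beta n) (/ INR n))) ->
  Delta2 beta ->
  forall phi : C -> C, symbol phi -> comp_bounded beta phi.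
Proof.
  intros Hbeta Hess Hlim Hd2 phi [[b Hb] [Hphi _]].
  destruct (comp_coef_beta_bound beta b phi Hbeta Hess Hlim Hd2 Hb Hphi) as [M [HM Hfin]].
  destruct (symbol_small_near_0 b phi Hb Hphi) as [r [rho [Hr [Hrho Hsmall]]]].
  exists M; split; auto. intros a Ha.
  set (c := fun m => Cseries (fun n => a n * cauchy_pow b n m)%C).
  assert (Hc : forall m, cseries (fun n => a n * cauchy_pow b n m)%C (c m)).
  (* Any [s] strictly between [rho] and 1 works: the growth of [a n] is at most [s ^ (-n)], and the
     decay [rho ^ n] wins. *)
  { intros m. set (s := (1 + rho) / 2).
    destruct (in_H2_coef_bound beta a s Hbeta Hlim Ha) as [B HB]; [unfold s; lra|].
    apply (Cseries_correct _ (fun n => B / r ^ m * (rho / s) ^ n)).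
    - intros n. rewrite Cmod_mult.
      assert (Hrm : 0 < r ^ m) by (apply pow_lt; lra).
      assert (Hs : 0 < s ^ n) by (apply pow_lt; unfold s; lra).
      assert (Hcp := cauchy_pow_bound b phi r rho n m Hb Hr Hrho Hsmall).
      specialize (HB n).
      assert (Hrn : 0 <= rho ^ n) by (apply pow_le; lra).
      apply Rmult_le_reg_r with (s ^ n * r ^ m); [apply Rmult_lt_0_compat; auto|].
      replace (B / r ^ m * (rho / s) ^ n * (s ^ n * r ^ m)) with (B * rho ^ n).
      + replace (Cmod (a n) * Cmod (cauchy_pow b n m) * (s ^ n * r ^ m)) with
          ((Cmod (a n) * s ^ n) * (Cmod (cauchy_pow b n m) * r ^ m)) by ring.
        apply Rmult_le_compat; auto; apply Rmult_le_pos; try lra; apply Cmod_ge_0.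
      + unfold Rdiv. rewrite Rpow_mult_distr, pow_inv. field. lra.
    - apply ex_series_scal_geom. split.
      + apply Rdiv_le_0_compat; unfold s; lra.
      + apply Rlt_div_l; unfold s; lra. }
  assert (Hdiff := comp_coef_limit_bound beta b a M c Hbeta HM Ha Hfin Hc).
  assert (Hpos : forall d k, 0 <= Cmod (d k) ^ 2 * beta k).
  { intros d k; apply Rmult_le_pos; [apply pow2_ge_0|left; auto]. }
  assert (Hcb : forall K, rsum (fun m => Cmod (c m) ^ 2 * beta m) K <= M * H2_norm2 beta a).
  { intros K. generalize (Hdiff O K). simpl rsum at 2. rewrite Rminus_0_r.
    intros H. eapply Rle_trans; [|exact H]. right. apply rsum_ext; intros m _.
    unfold comp_coef; simpl csum. replace (c m - 0)%C with (c m) by ring. reflexivity. }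
  assert (HcH : in_H2 beta c) by (apply (ex_series_bounded _ (M * H2_norm2 beta a)); auto).
  exists c. split; [exact HcH|split].
  2:{ apply (rsum_cv_le (fun m => Cmod (c m) ^ 2 * beta m)); auto. apply Series_correct; auto. }
  intros z Hz.
  assert (Hw := Hphi z Hz). unfold in_disk in Hw. generalize (Cmod_ge_0 (phi z)); intros Hw0.
  destruct (in_H2_coef_bound beta a ((1 + Cmod (phi z)) / 2) Hbeta Hlim Ha) as [B HB]; [lra|].
  assert (Hs0 : 0 < (1 + Cmod (phi z)) / 2) by lra.
  assert (Hs1 : Cmod (phi z) < (1 + Cmod (phi z)) / 2) by lra.
  assert (Hex := coef_bound_ex_series a _ B (phi z) Hs0 HB Hs1).
  destruct (ex_cseries (fun n => a n * phi z ^ n)%C _ (fun n => Rle_refl _) Hex) as [v Hv].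
  exists v. rewrite !is_pseries_iff. split; [exact Hv|].
  destruct (pev_sq_le beta z Hbeta Hlim Hz) as [W [HW HWd]].
  intros eps Heps.
  assert (Hn2 : is_series (fun n => Cmod (a n) ^ 2 * beta n) (H2_norm2 beta a)) by (apply Series_correct; auto).
  (* This threshold makes [W * M] times the tail of the norm series less than [(eps / 3) ^ 2];
     adding 1 keeps the denominator positive. *)
  destruct (proj1 (is_series_rsum _ _) Hn2 ((eps / 3) ^ 2 / (W * M + 1))) as [L1 HL1].
  { assert (0 <= W * M) by (apply Rmult_le_pos; auto).
    apply Rdiv_lt_0_compat; [apply pow_lt|]; lra. }
  destruct (Hv (eps / 3)) as [L2 HL2]; [lra|].
  set (L := max L1 L2).
  specialize (HL1 L (Nat.le_max_l _ _)). specialize (HL2 L (Nat.le_max_r _ _)).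
  (* The truncation [L] is fixed before [K] is chosen; the bound [H1] on the difference of
     coefficient sequences holds for every [k], so [K] may depend on [L]. *)
  assert (Hcomp := represents_comp b phi a L Hb z Hz). rewrite is_pseries_iff in Hcomp.
  destruct (Hcomp (eps / 3)) as [K HK]; [lra|].
  exists K; intros k Hk. specialize (HK k Hk).
  assert (H1 : Cmod (pev (fun m => c m - comp_coef b a L m)%C k z) < eps / 3).
  { apply Rnot_le_lt; intros Hge.
    assert (G1 := HWd (fun m => c m - comp_coef b a L m)%C k).
    assert (G2 := Hdiff L k).
    assert (G3 : (eps / 3) ^ 2 <= Cmod (pev (fun m => c m - comp_coef b a L m)%C k z) ^ 2)
      by (apply pow_incr; lra).
    apply Rabs_def2 in HL1.
    set (T := H2_norm2 beta a - rsum (fun n => Cmod (a n) ^ 2 * beta n) L) in *.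
    assert (HT : 0 <= T).
    { unfold T. generalize (rsum_le_series _ _ L (Hpos a) Hn2). lra. }
    assert (HWM : 0 <= W * M) by (apply Rmult_le_pos; auto).
    assert (G4 : T * (W * M + 1) < (eps / 3) ^ 2).
    { apply Rlt_div_r; [lra|]. unfold T; lra. }
    assert (G5 : W * rsum (fun m => Cmod (c m - comp_coef b a L m)%C ^ 2 * beta m) k <= W * (M * T))
      by (apply Rmult_le_compat_l; auto).
    nra. }
  rewrite pev_minus in H1.
  fold (pev a L (phi z)) in HL2. fold (pev (comp_coef b a L) k z) in HK. fold (pev c k z).
  replace (pev c k z - v)%C with
    ((pev c k z - pev (comp_coef b a L) k z) +
     ((pev (comp_coef b a L) k z - pev a L (phi z)) + (pev a L (phi z) - v)))%C by ring.
  eapply Rle_lt_trans; [apply Cmod_triangle|].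
  generalize (Cmod_triangle (pev (comp_coef b a L) k z - pev a L (phi z))%C (pev a L (phi z) - v)%C).
  lra.
Qed.
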